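(* Let $d \geq 2$ be an integer and let $\tau_1,\ldots,\tau_d$ be real numbers in $]0,1[$ such that $\tau_1 + \cdots + \tau_d > 1$. Let $f_1,\ldots,f_d$ be circle diffeomorphisms such that $f_k$ is of class $C^{1+\tau_k}$ for each $k \in \{1,\ldots,d\}$, the $f_k$ pairwise commute, and their rotation numbers $\rho(f_1),\ldots,\rho(f_d)$ are independent over the rationals. Then $f_1,\ldots,f_d$ are simultaneously topologically conjugate to rotations, i.e., there is a circle homeomorphism $\varphi$ such that $\varphi f_k \varphi^{-1}$ is a rotation for every $k$.
   Context: Circle diffeomorphisms are orientation preserving. A map is of class $C^{1+\tau}$ ($0<\tau<1$) if it is $C^1$ and its derivative is $\tau$-Hölder continuous. Elements $\rho_1,\ldots,\rho_d \in \mathbb{R}/\mathbb{Z}$ are independent over the rationals if no nontrivial linear combination of them with rational coefficients equals a rational number (i.e., if $q_1\rho_1+\cdots+q_d\rho_d \in \mathbb{Q}/\mathbb{Z}$ with $q_i \in \mathbb{Q}$, interpreted via real lifts, then all $q_i=0$). *)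

(* Defs.v *)
From Stdlib Require Import Reals Lra QArith Qreals.
From Coquelicot Require Import Coquelicot.
Open Scope R_scope.

(* Circle maps are represented by their lifts F : R -> R to the universal
   cover R -> R/Z. *)

Definition degree_one (F : R -> R) : Prop :=
  forall x, F (x + 1) = F x + 1.

Definition circle_homeo_lift (F : R -> R) : Prop :=
  degree_one F /\ (forall x, continuous F x) /\
  (forall x y, x < y -> F x < F y).

Definition circle_diffeo_C1tau (tau : R) (F : R -> R) : Prop :=
  degree_one F /\
  exists DF : R -> R,
    (forall x, is_derive F x (DF x)) /\
    (forall x, continuous DF x) /\
    (forall x, 0 < DF x) /\
    exists C : R, forall x y,
      Rabs (DF x - DF y) <= C * Rpower (Rabs (x - y)) tau.

Definition rot_num (F : R -> R) : R :=
  real (Lim_seq (fun n => Nat.iter (S n) F 0 / INR (S n))).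

Definition circle_commute (F G : R -> R) : Prop :=
  forall x, exists m : Z, F (G x) = G (F x) + IZR m.

(* phi f phi^{-1} is a rotation R_alpha, written without the inverse as
   phi o f = R_alpha o phi on the circle, i.e. on lifts up to integers. *)
Definition conj_to_rotation (Phi F : R -> R) : Prop :=
  exists alpha : R, forall x, exists m : Z, Phi (F x) = Phi x + alpha + IZR m.

Fixpoint sumR (n : nat) (g : nat -> R) : R :=
  match n with
  | O => 0
  | S n => sumR n g + g n
  end.

Definition rationally_independent (d : nat) (rho : nat -> R) : Prop :=
  forall q : nat -> Q,
    (exists r : Q, sumR d (fun k => Q2R (q k) * rho k) = Q2R r) ->
    forall k, (k < d)%nat -> q k == 0%Q.

(* Main.v *)
Require Import Defs.
From Stdlib Require Import Reals QArith Qreals.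
From Coquelicot Require Import Coquelicot.
From Stdlib Require Import ZArith Lra Lia List Classical FunctionalExtensionality.
Open Scope R_scope.

(** The commuting lifts have a common monotone semiconjugacy [Phi] to translations, which
    is continuous because the rotation numbers are irrational. Suppose that [Phi] is
    constant on a maximal interval [I]. By rational independence the images [F^v I], for
    [v] in [N^d], are disjoint on the circle, so the sum of their lengths is bounded.
    Let a step of a lattice path from [v] in direction [k] cost [|F^v I|^tau_k].
    Choose [m_k] with [m_k < tau_k M], where [M] is the sum of the [m_i]; a path with random
    corners at the scales [(2^(m_k j))_k], [j = 0, 1, ...], makes about [2^(m_k j)] steps in
    direction [k] at scale [j], each of average cost at most about [2^(- tau_k M j)], so its
    mean total cost is bounded by a geometric series. Hence there are paths of uniformly
    bounded cost ending at [v] with [|F^v I|] arbitrarily small. Bounded cost means bounded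
    distortion, so a fixed interval [J] adjacent to [I] satisfies [|F^v J| <= |F^v I|].
    But [Phi] grows by the same positive amount on every [F^v J], which contradicts its
    uniform continuity. *)

(** * Finite sums over lists and over initial segments of the integers *)

Definition lsum {A : Type} (l : list A) (g : A -> R) : R :=
  fold_right (fun x s => g x + s) 0 l.

Lemma lsum_cons {A : Type} (x : A) l g : lsum (x :: l) g = g x + lsum l g.
Proof. reflexivity. Qed.

Lemma lsum_app {A : Type} (l1 l2 : list A) g :
  lsum (l1 ++ l2) g = lsum l1 g + lsum l2 g.
Proof.
  induction l1 as [|x l1 IH]; simpl; [lra|].
  rewrite IH; lra.
Qed.

Lemma lsum_flat_map {A B : Type} (f : A -> list B) (l : list A) g :
  lsum (flat_map f l) g = lsum l (fun x => lsum (f x) g).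
Proof.
  induction l as [|x l IH]; simpl; [reflexivity|].
  rewrite lsum_app, IH; reflexivity.
Qed.

Lemma lsum_ge0 {A : Type} (l : list A) g :
  (forall x, 0 <= g x) -> 0 <= lsum l g.
Proof.
  intros H; induction l as [|x l IH]; simpl; [lra|].
  specialize (H x); lra.
Qed.

Lemma lsum_scal {A : Type} c (l : list A) g :
  lsum l (fun x => c * g x) = c * lsum l g.
Proof. induction l as [|x l IH]; simpl; [|rewrite IH]; ring. Qed.

Lemma lsum_const {A : Type} c (l : list A) :
  lsum l (fun _ => c) = INR (length l) * c.
Proof.
  induction l as [|x l IH]; [simpl; ring|].
  rewrite lsum_cons, IH; cbn [length]; rewrite S_INR; ring.
Qed.

Lemma lsum_filter {A : Type} (p : A -> bool) (l : list A) g :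
  lsum l g = lsum (filter p l) g + lsum (filter (fun x => negb (p x)) l) g.
Proof.
  induction l as [|x l IH]; simpl; [lra|].
  rewrite IH; destruct (p x); simpl; lra.
Qed.

Lemma lsum_seq n a g : lsum (seq a n) g = sumR n (fun x => g (a + x)%nat).
Proof.
  induction n as [|n IH]; [reflexivity|].
  rewrite seq_S, lsum_app, IH; simpl; ring.
Qed.

Lemma sumR_ext n g h : (forall x, (x < n)%nat -> g x = h x) -> sumR n g = sumR n h.
Proof.
  induction n as [|n IH]; simpl; intros H; [reflexivity|].
  rewrite IH, H; auto.
Qed.

Lemma sumR_le n g h : (forall x, (x < n)%nat -> g x <= h x) -> sumR n g <= sumR n h.
Proof.
  induction n as [|n IH]; simpl; intros H; [lra|].
  apply Rplus_le_compat; auto.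
Qed.

Lemma sumR_const n c : sumR n (fun _ => c) = INR n * c.
Proof. induction n as [|n IH]; [simpl; ring|]. rewrite S_INR; simpl; rewrite IH; ring. Qed.

Lemma sumR_ge0 n g : (forall x, (x < n)%nat -> 0 <= g x) -> 0 <= sumR n g.
Proof.
  intros H; replace 0 with (sumR n (fun _ => 0)) by (rewrite sumR_const; ring).
  apply sumR_le; auto.
Qed.

Lemma sumR_plus n g h : sumR n (fun x => g x + h x) = sumR n g + sumR n h.
Proof. induction n as [|n IH]; simpl; [|rewrite IH]; ring. Qed.

Lemma sumR_scal n c g : sumR n (fun x => c * g x) = c * sumR n g.
Proof. induction n as [|n IH]; simpl; [|rewrite IH]; ring. Qed.

Lemma sumR_add m n g : sumR (m + n) g = sumR m g + sumR n (fun x => g (m + x)%nat).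
Proof.
  induction n as [|n IH]; [rewrite Nat.add_0_r; simpl; ring|].
  rewrite Nat.add_succ_r; simpl; rewrite IH; ring.
Qed.

Lemma sumR_mono m n g :
  (m <= n)%nat -> (forall x, 0 <= g x) -> sumR m g <= sumR n g.
Proof.
  intros Hmn Hg; replace n with (m + (n - m))%nat by lia.
  rewrite sumR_add.
  pose proof (sumR_ge0 (n - m) (fun x => g (m + x)%nat) (fun x _ => Hg _)); lra.
Qed.

Lemma sumR_mod q B g :
  sumR (q * B) (fun x => g (x mod B)%nat) = INR q * sumR B g.
Proof.
  induction q as [|q IH]; [simpl; ring|].
  replace (S q * B)%nat with (q * B + B)%nat by (simpl; lia).
  rewrite sumR_add, IH, S_INR.
  rewrite (sumR_ext B (fun x => g ((q * B + x) mod B)%nat) g); [ring|].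
  intros x Hx; f_equal.
  rewrite Nat.add_comm, Nat.Div0.mod_add; apply Nat.mod_small, Hx.
Qed.

(** * Averages over boxes *)

Definition mean (n : nat) (g : nat -> R) : R := sumR n g / INR n.

Lemma mean_le n g h : (forall x, g x <= h x) -> mean n g <= mean n h.
Proof.
  intros H; unfold mean, Rdiv; apply Rmult_le_compat_r.
  - destruct n; [simpl; rewrite Rinv_0; lra|].
    left; apply Rinv_0_lt_compat, lt_0_INR; lia.
  - apply sumR_le; auto.
Qed.

Lemma mean_const n c : (0 < n)%nat -> mean n (fun _ => c) = c.
Proof.
  intros Hn; unfold mean; rewrite sumR_const; field.
  apply not_0_INR; lia.
Qed.

Lemma mean_plus n g h : mean n (fun x => g x + h x) = mean n g + mean n h.
Proof. unfold mean; rewrite sumR_plus; unfold Rdiv; ring. Qed.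

Lemma mean_scal n c g : mean n (fun x => c * g x) = c * mean n g.
Proof. unfold mean; rewrite sumR_scal; unfold Rdiv; ring. Qed.

(** First moment argument: if every value exceeded the mean, so would their average. *)
Lemma le_mean_ex n g : (0 < n)%nat -> exists x, g x <= mean n g.
Proof.
  intros Hn; apply NNPP; intros H.
  assert (Hlt : forall x, mean n g < g x)
    by (intros x; apply Rnot_le_lt; intros Hx; apply H; exists x; exact Hx).
  assert (Hs : forall k, sumR k (fun _ => mean n g) <= sumR k g
                 /\ ((0 < k)%nat -> sumR k (fun _ => mean n g) < sumR k g)).
  { induction k as [|k [IH _]]; simpl; [split; [lra|lia]|].
    specialize (Hlt k); split; intros; lra. }
  destruct (Hs n) as [_ Hs']; specialize (Hs' Hn).
  rewrite sumR_const in Hs'; unfold mean in Hs'.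
  assert (INR n <> 0) by (apply not_0_INR; lia).
  replace (INR n * (sumR n g / INR n)) with (sumR n g) in Hs' by (field; auto).
  lra.
Qed.

Lemma mean_mod q B g : (0 < q)%nat -> (0 < B)%nat ->
  mean (q * B) (fun x => g (x mod B)%nat) = mean B g.
Proof.
  intros Hq HB; unfold mean; rewrite sumR_mod, mult_INR; field.
  split; apply not_0_INR; lia.
Qed.

Definition upd (v : nat -> nat) (k x : nat) : nat -> nat :=
  fun i => if Nat.eqb i k then x else v i.

Lemma upd_same v k x : upd v k x k = x.
Proof. unfold upd; rewrite Nat.eqb_refl; reflexivity. Qed.

Lemma upd_other v k x i : i <> k -> upd v k x i = v i.
Proof. intros H; unfold upd; apply Nat.eqb_neq in H; rewrite H; reflexivity. Qed.

(** The expectation of [g] at a random point whose coordinates below [d] are independent, the [k]-th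
    uniform on [{0, ..., n k - 1}]; the other coordinates are those of [p]. *)
Fixpoint avg (d : nat) (n : nat -> nat) (g : (nat -> nat) -> R) (p : nat -> nat) : R :=
  match d with
  | O => g p
  | S k => mean (n k) (fun x => avg k n g (upd p k x))
  end.

Lemma avg_le d n g h p : (forall w, g w <= h w) -> avg d n g p <= avg d n h p.
Proof.
  intros H; revert p; induction d as [|d IH]; intros p; simpl; auto.
  apply mean_le; auto.
Qed.

Lemma avg_const d n c p : (forall k, (0 < n k)%nat) -> avg d n (fun _ => c) p = c.
Proof.
  intros Hn.
  revert p; induction d as [|d IH]; intros p; simpl; [reflexivity|].
  transitivity (mean (n d) (fun _ => c)); [|apply mean_const, Hn].
  f_equal; apply functional_extensionality; auto.
Qed.

Lemma avg_plus d n g h p :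
  avg d n (fun w => g w + h w) p = avg d n g p + avg d n h p.
Proof.
  revert p; induction d as [|d IH]; intros p; simpl; [reflexivity|].
  rewrite <- mean_plus; f_equal; apply functional_extensionality; auto.
Qed.

Lemma avg_scal d n c g p : avg d n (fun w => c * g w) p = c * avg d n g p.
Proof.
  revert p; induction d as [|d IH]; intros p; simpl; [reflexivity|].
  rewrite <- mean_scal; f_equal; apply functional_extensionality; auto.
Qed.

Lemma avg_sumR d n N (g : nat -> (nat -> nat) -> R) p : (forall k, (0 < n k)%nat) ->
  avg d n (fun w => sumR N (fun x => g x w)) p = sumR N (fun x => avg d n (g x) p).
Proof.
  intros Hn; induction N as [|N IH]; simpl; [apply avg_const, Hn|].
  rewrite avg_plus, IH; reflexivity.
Qed.

Lemma le_avg_ex d n g p : (forall k, (0 < n k)%nat) -> exists w, g w <= avg d n g p.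
Proof.
  intros Hn.
  revert p; induction d as [|d IH]; intros p; simpl; [exists p; lra|].
  destruct (le_mean_ex (n d) (fun x => avg d n g (upd p d x)) (Hn d)) as [x Hx].
  destruct (IH (upd p d x)) as [w Hw]; exists w; lra.
Qed.

Fixpoint box (d : nat) (L : nat -> list nat) (v : nat -> nat) : list (nat -> nat) :=
  match d with
  | O => v :: nil
  | S k => flat_map (fun y => box k L (upd v k y)) (L k)
  end.

Lemma box_above d L v w i : In w (box d L v) -> (d <= i)%nat -> w i = v i.
Proof.
  revert v; induction d as [|d IH]; simpl; intros v Hw Hi.
  - destruct Hw as [->|[]]; reflexivity.
  - apply in_flat_map in Hw; destruct Hw as [y [_ Hw]].
    rewrite (IH _ Hw) by lia; apply upd_other; lia.
Qed.

Lemma box_below d L v w i : In w (box d L v) -> (i < d)%nat -> In (w i) (L i).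
Proof.
  revert v; induction d as [|d IH]; simpl; intros v Hw Hi; [lia|].
  apply in_flat_map in Hw; destruct Hw as [y [Hy Hw]].
  destruct (Nat.eq_dec i d) as [->|]; [|apply (IH _ Hw); lia].
  rewrite (box_above _ _ _ _ _ Hw), upd_same by lia; exact Hy.
Qed.

Lemma NoDup_flat_map {A B : Type} (f : A -> list B) (l : list A) :
  NoDup l -> (forall x, In x l -> NoDup (f x)) ->
  (forall x y z, In x l -> In y l -> In z (f x) -> In z (f y) -> x = y) ->
  NoDup (flat_map f l).
Proof.
  induction 1 as [|x l Hx Hl IH]; simpl; intros Hf Hd; [constructor|].
  apply NoDup_app; auto.
  - apply IH; auto. intros y y' z; intros; apply (Hd y y' z); auto.
  - intros z Hz Hz'; apply in_flat_map in Hz'; destruct Hz' as [y [Hy Hz']].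
    apply Hx; rewrite (Hd x y z); auto.
Qed.

Lemma box_NoDup d L v : (forall i, NoDup (L i)) -> NoDup (box d L v).
Proof.
  intros HL; revert v; induction d as [|d IH]; simpl; intros v.
  - constructor; [auto|constructor].
  - apply NoDup_flat_map; auto.
    intros x y z _ _ Hx Hy.
    apply box_above with (i := d) in Hx; [|lia].
    apply box_above with (i := d) in Hy; [|lia].
    rewrite upd_same in Hx, Hy; congruence.
Qed.

Fixpoint prodR (n : nat) (g : nat -> R) : R :=
  match n with
  | O => 1
  | S n => prodR n g * g n
  end.

Lemma prodR_ge0 n g : (forall i, 0 <= g i) -> 0 <= prodR n g.
Proof.
  intros H; induction n as [|n IH]; simpl; [lra|].
  apply Rmult_le_pos; auto.
Qed.

Lemma prodR_le n g h :
  (forall i, (i < n)%nat -> 0 <= g i <= h i) -> 0 <= prodR n g <= prodR n h.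
Proof.
  induction n as [|n IH]; simpl; intros H; [lra|].
  destruct IH as [H0 H1]; [intros; apply H; lia|].
  destruct (H n) as [H2 H3]; [lia|]; split.
  - apply Rmult_le_pos; auto.
  - apply Rmult_le_compat; auto.
Qed.

(** Meant for a line in direction [k]: that coordinate is not random, so its factor is 1 instead of
    the inverse power of 2 found in the other directions. *)
Lemma prodR_le_except n g h k B :
  (k < n)%nat -> g k = B * h k -> 0 <= B ->
  (forall i, 0 <= h i) ->
  (forall i, (i < n)%nat -> i <> k -> 0 <= g i <= h i) ->
  prodR n g <= B * prodR n h.
Proof.
  intros Hk Hgk HB Hh; induction n as [|n IH]; simpl; intros Hg; [lia|].
  destruct (Nat.eq_dec k n) as [->|Hkn].
  - rewrite Hgk.
    assert (prodR n g <= prodR n h) by (apply prodR_le; intros; apply Hg; lia).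
    pose proof (Rmult_le_pos _ _ HB (Hh n)); nra.
  - assert (IH' : prodR n g <= B * prodR n h)
      by (apply IH; [lia|intros; apply Hg; lia]).
    destruct (Hg n) as [H0 H1]; [lia|lia|].
    pose proof (Rmult_le_pos _ _ HB (prodR_ge0 n h Hh)).
    apply Rle_trans with (B * prodR n h * g n);
      [apply Rmult_le_compat_r; auto|].
    rewrite <- Rmult_assoc; apply Rmult_le_compat_l; auto.
Qed.

(** The last hypothesis says that the random coordinate [P i x] has density at most [c i] with
    respect to counting measure on [L i]. The coordinates are independent, so the joint density on
    the product of the [L i] is at most the product of the [c i]. *)
Lemma avg_le_box d n (P : nat -> nat -> nat) (L : nat -> list nat) (c : nat -> R) g p :
  (forall i, 0 <= c i) -> (forall w, 0 <= g w) ->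
  (forall i h, (i < d)%nat -> (forall y, 0 <= h y) ->
     mean (n i) (fun x => h (P i x)) <= c i * lsum (L i) h) ->
  avg d n (fun w => g (fun i => P i (w i))) p
    <= prodR d c * lsum (box d L (fun i => P i (p i))) g.
Proof.
  intros Hc Hg; revert p; induction d as [|d IH]; simpl; intros p H; [lra|].
  set (h y := prodR d c * lsum (box d L (upd (fun i => P i (p i)) d y)) g).
  apply Rle_trans with (mean (n d) (fun x => h (P d x))).
  - apply mean_le; intros x.
    apply Rle_trans with (1 := IH (upd p d x) (fun i h' Hi => H i h' (Nat.lt_lt_succ_r _ _ Hi))).
    unfold h; right; f_equal; f_equal; f_equal.
    apply functional_extensionality; intros i.
    unfold upd; destruct (Nat.eqb_spec i d) as [->|]; reflexivity.
  - apply Rle_trans with (1 := H d h (Nat.lt_succ_diag_r d)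
      (fun y => Rmult_le_pos _ _ (prodR_ge0 d c Hc) (lsum_ge0 _ _ Hg))).
    unfold h; rewrite lsum_flat_map, lsum_scal; right; ring.
Qed.

(** * Cheap monotone lattice paths *)

(** The weight [a v] will be the length of the image of a fixed interval under [F^v]. A step is
    charged at its starting point because [F k] is then applied to that image. *)
Inductive lattice_path (d : nat) (a : (nat -> nat) -> R) (tau : nat -> R) :
    (nat -> nat) -> R -> Prop :=
| lattice_path_nil : lattice_path d a tau (fun _ => 0%nat) 0
| lattice_path_step v c k : (k < d)%nat -> lattice_path d a tau v c ->
    lattice_path d a tau (upd v k (S (v k))) (c + Rpower (a v) (tau k)).

Lemma upd_id v k : upd v k (v k) = v.
Proof.
  apply functional_extensionality; intros i; unfold upd.
  destruct (Nat.eqb_spec i k) as [->|]; reflexivity.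
Qed.

Lemma upd_upd v k x y : upd (upd v k x) k y = upd v k y.
Proof.
  apply functional_extensionality; intros i; unfold upd.
  destruct (Nat.eqb_spec i k); reflexivity.
Qed.

Lemma lattice_path_segment d a tau v c k n :
  (k < d)%nat -> lattice_path d a tau v c ->
  lattice_path d a tau (upd v k (v k + n)%nat)
    (c + sumR n (fun i => Rpower (a (upd v k (v k + i)%nat)) (tau k))).
Proof.
  intros Hk Hv; induction n as [|n IH]; simpl.
  - rewrite Nat.add_0_r, upd_id, Rplus_0_r; exact Hv.
  - rewrite <- Rplus_assoc, Nat.add_succ_r.
    pose proof (lattice_path_step _ _ _ _ _ _ Hk IH) as H.
    rewrite upd_same, upd_upd in H; exact H.
Qed.

Lemma Rpower_gt0 x y : 0 < Rpower x y.
Proof. apply exp_pos. Qed.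

(** The points reached between two corners [p] and [p'] when the coordinates are changed one after
    the other. *)
Definition splice (k : nat) (p p' : nat -> nat) : nat -> nat :=
  fun i => if Nat.ltb i k then p' i else p i.

(** The path moves from [p] to [p'] one direction at a time. Each segment is charged for the whole
    line from 0 to [X k - 1], so that the bound in direction [k] depends only on the other
    coordinates of the two corners. *)
Lemma lattice_path_splice d a tau p p' c (X : nat -> nat) m :
  (m <= d)%nat -> (forall i, (p i <= p' i <= X i)%nat) ->
  lattice_path d a tau p c ->
  exists c', lattice_path d a tau (splice m p p') c' /\
    c' <= c + sumR m (fun k => sumR (X k) (fun x =>
                Rpower (a (upd (splice k p p') k x)) (tau k))).
Proof.
  intros Hm HX Hp; induction m as [|m IH].
  - exists c; split; [|simpl; lra].
    replace (splice 0 p p') with p; [exact Hp|].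
    apply functional_extensionality; intros i; reflexivity.
  - destruct IH as [c' [Hc' Hle]]; [lia|].
    pose proof (lattice_path_segment _ _ _ _ _ m (p' m - p m) Hm Hc') as H.
    assert (E : splice m p p' m = p m)
      by (unfold splice; rewrite Nat.ltb_irrefl; reflexivity).
    assert (E' : upd (splice m p p') m (p m + (p' m - p m))%nat = splice (S m) p p').
    { specialize (HX m); apply functional_extensionality; intros i; unfold upd, splice.
      destruct (Nat.eqb_spec i m) as [->|].
      - destruct (Nat.ltb_spec m (S m)); lia.
      - destruct (Nat.ltb_spec i m), (Nat.ltb_spec i (S m)); lia. }
    rewrite E, E' in H.
    eexists; split; [exact H|]; simpl.
    apply Rle_trans with (c' + sumR (X m)
      (fun x => Rpower (a (upd (splice m p p') m x)) (tau m))); [|lra].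
    apply Rplus_le_compat_l.
    replace (X m) with (p m + (X m - p m))%nat by (specialize (HX m); lia).
    rewrite sumR_add.
    assert (H0 : 0 <= sumR (p m)
      (fun x => Rpower (a (upd (splice m p p') m x)) (tau m)))
      by (apply sumR_ge0; intros; left; apply Rpower_gt0).
    assert (H1 : sumR (p' m - p m)
        (fun i => Rpower (a (upd (splice m p p') m (p m + i)%nat)) (tau m))
      <= sumR (X m - p m)
        (fun i => Rpower (a (upd (splice m p p') m (p m + i)%nat)) (tau m))).
    { apply sumR_mono; [specialize (HX m); lia|]; intros; left; apply Rpower_gt0. }
    lra.
Qed.

(* Replaces Jensen's inequality: averaging the right-hand side only needs the average of [a]. *)
Lemma Rpower_le_affine a s t : 0 < a -> 0 < s -> 0 < t < 1 ->
  Rpower a t <= Rpower s t + Rpower s (t - 1) * a.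
Proof.
  intros Ha Hs Ht.
  pose proof (Rpower_gt0 s t); pose proof (Rpower_gt0 s (t - 1)).
  destruct (Rle_dec a s) as [Has|Has].
  - assert (Rpower a t <= Rpower s t) by (apply Rle_Rpower_l; lra).
    pose proof (Rmult_lt_0_compat (Rpower s (t - 1)) a); lra.
  - assert (E : Rpower a t = Rpower a (t - 1) * a).
    { rewrite <- (Rpower_1 a) at 3 by lra.
      rewrite <- Rpower_plus; f_equal; lra. }
    assert (Rpower a (t - 1) <= Rpower s (t - 1)).
    { replace (t - 1) with (- (1 - t)) by lra; rewrite !Rpower_Ropp.
      apply Rinv_le_contravar; [apply Rpower_gt0|].
      apply Rle_Rpower_l; lra. }
    assert (Rpower a (t - 1) * a <= Rpower s (t - 1) * a)
      by (apply Rmult_le_compat_r; lra).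
    lra.
Qed.

(** * Random corners at geometric scales *)

Lemma sumR_swap m n (g : nat -> nat -> R) :
  sumR m (fun i => sumR n (fun j => g i j)) = sumR n (fun j => sumR m (fun i => g i j)).
Proof.
  induction m as [|m IH]; simpl; [rewrite sumR_const; ring|].
  rewrite IH, <- sumR_plus; reflexivity.
Qed.

Lemma sumR_geom_le r n : 0 <= r < 1 -> sumR n (fun j => r ^ j) <= / (1 - r).
Proof.
  intros Hr.
  assert (E : sumR n (fun j => r ^ j) * (1 - r) = 1 - r ^ n)
    by (induction n as [|n IH]; simpl; [ring|rewrite Rmult_plus_distr_r, IH; ring]).
  apply Rmult_le_reg_r with (1 - r); [lra|].
  rewrite E, Rinv_l by lra.
  pose proof (pow_le r n (proj1 Hr)); lra.
Qed.

(** Take [m k] to be the integer part of [tau k * N] with [N > d / (sum tau - 1)]. Rounding loses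
    less than [d] in total, so the sum [M] of the [m k] still exceeds [N], and
    [m k <= tau k * N < tau k * M]. *)
Lemma exponents_ex d tau :
  (forall k, (k < d)%nat -> 0 < tau k < 1) -> sumR d tau > 1 ->
  exists m : nat -> nat, (forall k, (d <= k)%nat -> m k = 0%nat) /\
    0 < sumR d (fun i => INR (m i)) /\
    forall k, (k < d)%nat -> INR (m k) < tau k * sumR d (fun i => INR (m i)).
Proof.
  intros Htau Hsum.
  destruct (nfloor_ex (INR d / (sumR d tau - 1))) as [N0 HN0].
  { apply Rmult_le_pos; [apply pos_INR|left; apply Rinv_0_lt_compat; lra]. }
  set (N := INR (S N0)).
  assert (HN : INR d < (sumR d tau - 1) * N).
  { unfold N; rewrite S_INR.
    apply Rmult_lt_reg_l with (/ (sumR d tau - 1)); [apply Rinv_0_lt_compat; lra|].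
    rewrite <- Rmult_assoc, Rinv_l, Rmult_1_l by lra.
    unfold Rdiv in HN0; lra. }
  assert (HN1 : 0 < N) by (apply lt_0_INR; lia).
  (* [Rmax 0] supplies the nonnegativity that [nfloor_ex] asks for; for [k < d] it changes
     nothing. *)
  set (m := fun k => if Nat.ltb k d
    then proj1_sig (nfloor_ex (Rmax 0 (tau k * N)) (Rmax_l 0 _)) else 0%nat).
  assert (Hm : forall k, (k < d)%nat -> tau k * N - 1 < INR (m k) <= tau k * N).
  { intros k Hk; unfold m; destruct (Nat.ltb_spec k d) as [_|]; [|lia].
    destruct (nfloor_ex _ _) as [n Hn]; simpl.
    rewrite Rmax_right in Hn by (apply Rmult_le_pos; [apply Rlt_le, Htau, Hk|lra]).
    lra. }
  exists m.
  assert (HM : N < sumR d (fun i => INR (m i))).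
  { apply Rlt_le_trans with (sumR d (fun k => N * tau k + - 1)).
    - rewrite sumR_plus, sumR_scal, sumR_const; lra.
    - apply sumR_le; intros k Hk; specialize (Hm k Hk); lra. }
  split; [|split; [lra|]].
  - intros k Hk; unfold m; destruct (Nat.ltb_spec k d); [lia|reflexivity].
  - intros k Hk; specialize (Hm k Hk); specialize (Htau k Hk); nra.
Qed.

(* [corner m j i y] is a coordinate in [2^(m i j) - 1, 2 (2^(m i j) - 1)], uniformly
   distributed when [y] is uniform modulo a multiple of [2^(m i j)]. *)
Definition corner (m : nat -> nat) (j i y : nat) : nat :=
  (2 ^ (m i * j) - 1 + y mod 2 ^ (m i * j))%nat.

Lemma pow2_gt0 n : (0 < 2 ^ n)%nat.
Proof. pose proof (Nat.pow_nonzero 2 n); lia. Qed.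

(** Successive corners are always comparable, whatever the random choices. If [m i = 0], both
    coordinates are 0; otherwise the power of 2 at least doubles, and the range at scale [j] ends at
    [2 (B - 1) <= B' - 1], where the next one begins. *)
Lemma corner_le m j i y :
  (corner m j i y <= corner m (S j) i y <= 2 * 2 ^ (m i * S j))%nat.
Proof.
  unfold corner.
  set (B := (2 ^ (m i * j))%nat); set (B' := (2 ^ (m i * S j))%nat).
  assert (HB : (0 < B)%nat) by apply pow2_gt0.
  assert (HB' : (0 < B')%nat) by apply pow2_gt0.
  pose proof (Nat.mod_upper_bound y B); pose proof (Nat.mod_upper_bound y B').
  assert (H1 : (B = B' /\ B = 1 \/ 2 * B <= B')%nat).
  { unfold B, B'; destruct (m i) as [|n]; [left; auto|right].
    replace (S n * S j)%nat with (S n * j + n + 1)%nat by lia.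
    rewrite !Nat.pow_add_r.
    pose proof (pow2_gt0 n); pose proof (pow2_gt0 (S n * j)); simpl; nia. }
  destruct H1 as [[H1 H2]|H1]; [rewrite <- H1, H2 in *; simpl in *|]; lia.
Qed.

(** One random [y] serves all scales: [2^(m i l)] divides [2^(m i J)] for [l <= J], so its residue
    is uniform at each of them. *)
Lemma mean_corner m J l i h : (l <= J)%nat ->
  mean (2 ^ (m i * J)) (fun y => h (corner m l i y))
  = / INR (2 ^ (m i * l))
    * lsum (seq (2 ^ (m i * l) - 1) (2 ^ (m i * l))) h.
Proof.
  intros Hl; unfold corner; set (B := (2 ^ (m i * l))%nat).
  replace (2 ^ (m i * J))%nat with (2 ^ (m i * (J - l)) * B)%nat.
  - rewrite (mean_mod _ _ (fun y => h (B - 1 + y)%nat)) by apply pow2_gt0.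
    rewrite lsum_seq; unfold mean, Rdiv; ring.
  - unfold B; rewrite <- Nat.pow_add_r; f_equal; nia.
Qed.

Lemma prodR_inv_pow2 d m j :
  prodR d (fun i => / INR (2 ^ (m i * j)))
  = Rpower 2 (- (INR j * sumR d (fun i => INR (m i)))).
Proof.
  induction d as [|d IH]; simpl.
  - rewrite Rmult_0_r, Ropp_0, Rpower_O by lra; reflexivity.
  - rewrite IH, pow_INR, <- Rpower_pow by (simpl; lra).
    rewrite <- Rpower_Ropp, <- Rpower_plus, mult_INR.
    f_equal; simpl; ring.
Qed.

(** The scale of coordinate [i] while the path from corner [j] to corner [j + 1] moves in direction
    [k]: the directions before [k] have already been updated. *)
Definition corner_side (m : nat -> nat) (j k i : nat) : nat :=
  if Nat.ltb i k then S j else j.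

(** A random line in direction [k] picks each admissible position of the other coordinates with
    probability at most the product of [2^(- m i j)] over [i <> k]. The points of all these lines
    are distinct and carry total mass at most 2. *)
Lemma avg_line_le d a (m : nat -> nat) J j k X :
  (forall i, (d <= i)%nat -> m i = 0%nat) ->
  (forall v, 0 < a v) ->
  (forall s, NoDup s -> (forall v i, In v s -> (d <= i)%nat -> v i = 0%nat) ->
     lsum s a <= 2) ->
  (k < d)%nat -> (j < J)%nat ->
  sumR X (fun x => avg d (fun i => (2 ^ (m i * J))%nat)
    (fun w => a (upd (fun i => corner m (corner_side m j k i) i (w i)) k x))
    (fun _ => 0%nat))
  <= 2 * INR (2 ^ (m k * j)) * prodR d (fun i => / INR (2 ^ (m i * j))).
Proof.
  intros Hm Ha Hmass Hk Hj.
  set (l := corner_side m j k).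
  set (P x i y := if Nat.eqb i k then x else corner m (l i) i y).
  set (L x i := if Nat.eqb i k then x :: nil
    else seq (2 ^ (m i * l i) - 1) (2 ^ (m i * l i))).
  set (c i := if Nat.eqb i k then 1 else / INR (2 ^ (m i * l i))).
  (* All points that can lie on the random line, listed by their coordinate [x] in direction [k]. *)
  set (s := flat_map (fun x => box d (L x) (fun i => P x i 0%nat)) (seq 0 X)).
  assert (Hpos : forall n, 0 < INR (2 ^ n)) by (intros n; apply lt_0_INR, pow2_gt0).
  assert (Hl : forall i, (j <= l i <= S j)%nat)
    by (intros i; unfold l, corner_side; destruct (Nat.ltb i k); lia).
  assert (Hc : forall i, 0 <= c i).
  { intros i; unfold c; destruct (Nat.eqb i k); [lra|].
    left; apply Rinv_0_lt_compat, Hpos. }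
  assert (Hs : lsum s a <= 2).
  { apply Hmass.
    - apply NoDup_flat_map; [apply seq_NoDup| |].
      + intros x _; apply box_NoDup; intros i; unfold L.
        destruct (Nat.eqb i k); [|apply seq_NoDup].
        constructor; [simpl; tauto|constructor].
      + intros x y z _ _ Hx Hy.
        apply box_below with (i := k) in Hx; [|exact Hk].
        apply box_below with (i := k) in Hy; [|exact Hk].
        unfold L in Hx, Hy; rewrite Nat.eqb_refl in Hx, Hy; simpl in Hx, Hy.
        destruct Hx as [Hx|[]], Hy as [Hy|[]]; congruence.
    - intros v i Hv Hi; apply in_flat_map in Hv; destruct Hv as [x [_ Hv]].
      rewrite (box_above _ _ _ _ _ Hv Hi); unfold P.
      destruct (Nat.eqb_spec i k); [lia|].
      unfold corner; rewrite (Hm i Hi); reflexivity. }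
  (* Coordinates already at scale [j + 1] have a density no larger than at scale [j]; the missing
     factor in direction [k] is restored by [2^(m k j)]. *)
  assert (Hprod : prodR d c
    <= INR (2 ^ (m k * j)) * prodR d (fun i => / INR (2 ^ (m i * j)))).
  { apply prodR_le_except with (k := k); auto.
    - unfold c; rewrite Nat.eqb_refl, Rinv_r; [reflexivity|].
      apply Rgt_not_eq, Hpos.
    - apply Rlt_le, Hpos.
    - intros i; left; apply Rinv_0_lt_compat, Hpos.
    - intros i _ Hik; split; [apply Hc|].
      unfold c; destruct (Nat.eqb_spec i k); [lia|].
      apply Rinv_le_contravar; [apply Hpos|].
      apply le_INR, Nat.pow_le_mono_r; [lia|].
      apply Nat.mul_le_mono_l, Hl. }
  apply Rle_trans with (prodR d c * lsum s a).
  - unfold s; rewrite lsum_flat_map, lsum_seq, <- sumR_scal.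
    apply sumR_le; intros x _; simpl.
    replace (fun w : nat -> nat => a (upd (fun i => corner m (l i) i (w i)) k x))
      with (fun w : nat -> nat => a (fun i => P x i (w i))).
    2:{ apply functional_extensionality; intros w; f_equal. }
    apply avg_le_box; auto; [intros w; left; apply Ha|].
    intros i h _ Hh; unfold P, L, c; destruct (Nat.eqb i k).
    + rewrite mean_const by apply pow2_gt0; simpl; lra.
    + rewrite mean_corner; [lra|specialize (Hl i); lia].
  - pose proof (prodR_ge0 d c Hc).
    apply Rle_trans with (prodR d c * 2); [apply Rmult_le_compat_l; auto|lra].
Qed.

(** Same density argument for the corner itself, which is uniform on a box with [2^(J M)] points,
    [M] being the sum of the [m i] over [i < d]. *)
Lemma avg_corner_le d a (m : nat -> nat) J :
  (forall i, (d <= i)%nat -> m i = 0%nat) ->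
  (forall v, 0 < a v) ->
  (forall s, NoDup s -> (forall v i, In v s -> (d <= i)%nat -> v i = 0%nat) ->
     lsum s a <= 2) ->
  avg d (fun i => (2 ^ (m i * J))%nat)
    (fun w => a (fun i => corner m J i (w i))) (fun _ => 0%nat)
  <= 2 * prodR d (fun i => / INR (2 ^ (m i * J))).
Proof.
  intros Hm Ha Hmass.
  assert (Hc : forall i, 0 <= / INR (2 ^ (m i * J)))
    by (intros i; left; apply Rinv_0_lt_compat, lt_0_INR, pow2_gt0).
  pose proof (prodR_ge0 d _ Hc) as Hp.
  set (L i := seq (2 ^ (m i * J) - 1) (2 ^ (m i * J))).
  set (s := box d L (fun i => corner m J i 0)).
  assert (Hs : lsum s a <= 2).
  { apply Hmass.
    - apply box_NoDup; intros i; apply seq_NoDup.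
    - intros v i Hv Hi; unfold s in Hv; rewrite (box_above _ _ _ _ _ Hv Hi).
      unfold corner; rewrite (Hm i Hi); reflexivity. }
  apply Rle_trans with (prodR d (fun i => / INR (2 ^ (m i * J))) * lsum s a).
  - apply avg_le_box; auto; [intros w; left; apply Ha|].
    intros i h _ _; rewrite mean_corner by lia; apply Rle_refl.
  - apply Rle_trans with (prodR d (fun i => / INR (2 ^ (m i * J))) * 2);
      [apply Rmult_le_compat_l; auto|lra].
Qed.

(** Put [s = 2^(- j M)], the inverse of the number of points of the box at scale [j]. By the affine
    bound at [s], the [2 * 2^(m k (j+1))] points of the line cost [s^tau] each, plus [s^(tau - 1)]
    times their expected mass, at most [2 * 2^(m k j) * s]. Both terms are multiples of
    [2^(m k j) * s^tau], the [j]-th power of the ratio in the conclusion. *)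
Lemma avg_cost_le d a tau (m : nat -> nat) J j k :
  (forall i, (d <= i)%nat -> m i = 0%nat) ->
  (forall v, 0 < a v) ->
  (forall s, NoDup s -> (forall v i, In v s -> (d <= i)%nat -> v i = 0%nat) ->
     lsum s a <= 2) ->
  0 < tau < 1 -> (k < d)%nat -> (j < J)%nat ->
  avg d (fun i => (2 ^ (m i * J))%nat)
    (fun w => sumR (2 * 2 ^ (m k * S j)) (fun x => Rpower
       (a (upd (fun i => corner m (corner_side m j k i) i (w i)) k x)) tau))
    (fun _ => 0%nat)
  <= (2 * 2 ^ m k + 2)
     * Rpower 2 (INR (m k) - tau * sumR d (fun i => INR (m i))) ^ j.
Proof.
  intros Hm Ha Hmass Ht Hk Hj.
  assert (Hn : forall i, (0 < 2 ^ (m i * J))%nat) by (intros; apply pow2_gt0).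
  set (X := (2 * 2 ^ (m k * S j))%nat).
  pose proof (avg_line_le d a m J j k X Hm Ha Hmass Hk Hj) as Hline.
  rewrite prodR_inv_pow2 in Hline.
  set (M := sumR d (fun i => INR (m i))) in *.
  set (s := Rpower 2 (- (INR j * M))) in *.
  assert (Hs : 0 < s) by apply Rpower_gt0.
  rewrite avg_sumR by exact Hn.
  apply Rle_trans with (sumR X (fun x => Rpower s tau + Rpower s (tau - 1) *
    avg d (fun i => (2 ^ (m i * J))%nat)
      (fun w => a (upd (fun i => corner m (corner_side m j k i) i (w i)) k x))
      (fun _ => 0%nat))).
  - apply sumR_le; intros x _.
    rewrite <- avg_scal, <- (avg_const d (fun i => (2 ^ (m i * J))%nat)
      (Rpower s tau) (fun _ => 0%nat) Hn), <- avg_plus.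
    apply avg_le; intros w.
    apply Rpower_le_affine; auto.
  - rewrite sumR_plus, sumR_scal, sumR_const.
    apply Rle_trans with (INR X * Rpower s tau
      + Rpower s (tau - 1) * (2 * INR (2 ^ (m k * j)) * s)).
    { apply Rplus_le_compat_l, Rmult_le_compat_l; [left; apply Rpower_gt0|exact Hline]. }
    replace (Rpower s (tau - 1) * (2 * INR (2 ^ (m k * j)) * s))
      with (2 * INR (2 ^ (m k * j)) * Rpower s tau).
    2:{ replace (Rpower s tau) with (Rpower s (tau - 1) * Rpower s 1).
        - rewrite (Rpower_1 s) by exact Hs; ring.
        - rewrite <- Rpower_plus; f_equal; ring. }
    assert (EX : INR X = 2 * 2 ^ m k * INR (2 ^ (m k * j))).
    { unfold X; rewrite mult_INR, !pow_INR.
      replace (m k * S j)%nat with (m k + m k * j)%nat by lia.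
      rewrite pow_add; replace (INR 2) with 2 by (simpl; ring); ring. }
    rewrite EX.
    assert (E : INR (2 ^ (m k * j)) * Rpower s tau = Rpower 2 (INR (m k) - tau * M) ^ j).
    { unfold s; rewrite Rpower_mult, pow_INR, <- Rpower_pow by (simpl; lra).
      rewrite <- Rpower_pow, Rpower_mult by apply Rpower_gt0.
      replace (INR 2) with 2 by (simpl; ring).
      rewrite <- Rpower_plus, mult_INR; f_equal; ring. }
    rewrite <- E; right; ring.
Qed.

(** First moment method for the cost of the random path plus a large multiple of [a] at its end: the
    expectation is bounded independently of [eps], so one choice of the corners makes both terms
    small enough. *)
Lemma cheap_path d a tau :
  (forall k, (k < d)%nat -> 0 < tau k < 1) -> sumR d tau > 1 ->
  (forall v, 0 < a v) ->
  (forall s, NoDup s -> (forall v i, In v s -> (d <= i)%nat -> v i = 0%nat) ->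
     lsum s a <= 2) ->
  exists C, forall eps, 0 < eps ->
    exists v c, lattice_path d a tau v c /\ c <= C /\ a v < eps.
Proof.
  intros Htau Hsum Ha Hmass.
  destruct (exponents_ex d tau Htau Hsum) as [m [Hm [HM Hmk]]].
  set (M := sumR d (fun i => INR (m i))) in *.
  set (r k := Rpower 2 (INR (m k) - tau k * M)).
  assert (Hr : forall k, (k < d)%nat -> 0 < r k < 1).
  { intros k Hk; split; [apply Rpower_gt0|].
    unfold r; rewrite <- (Rpower_O 2) by lra.
    apply Rpower_lt; [lra|]; specialize (Hmk k Hk); lra. }
  set (C0 := sumR d (fun k => (2 * 2 ^ m k + 2) * / (1 - r k))).
  assert (HC0 : 0 <= C0).
  { apply sumR_ge0; intros k Hk; specialize (Hr k Hk).
    apply Rmult_le_pos; [|left; apply Rinv_0_lt_compat; lra].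
    pose proof (pow_lt 2 (m k)); lra. }
  exists (C0 + 1); intros eps Heps.
  (* A total of at most [C0 + 1] will give [a <= delta * (C0 + 1) < eps] at the end of the path. *)
  set (delta := eps / (C0 + 2)).
  assert (Hdelta : 0 < delta) by (apply Rdiv_lt_0_compat; lra).
  (* [J] is large enough for the expectation of [a] at the last corner, at most [2 * 2^(- M J)], to
     be below [delta]. *)
  destruct (pow_lt_1_zero (Rpower 2 (- M))) with (y := delta / 2) as [J HJ].
  { rewrite Rabs_pos_eq by (left; apply Rpower_gt0).
    rewrite <- (Rpower_O 2) by lra; apply Rpower_lt; lra. }
  { lra. }
  specialize (HJ J (Nat.le_refl J)).
  rewrite Rabs_pos_eq in HJ by (apply pow_le; left; apply Rpower_gt0).
  rewrite <- Rpower_pow, Rpower_mult in HJ by apply Rpower_gt0.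
  set (n i := (2 ^ (m i * J))%nat).
  assert (Hn : forall i, (0 < n i)%nat) by (intros; apply pow2_gt0).
  set (cost j k w := sumR (2 * 2 ^ (m k * S j)) (fun x => Rpower
    (a (upd (fun i => corner m (corner_side m j k i) i (w i)) k x)) (tau k))).
  set (total w := sumR J (fun j => sumR d (fun k => cost j k w))
    + / delta * a (fun i => corner m J i (w i))).
  destruct (le_avg_ex d n total (fun _ => 0%nat) Hn) as [w Hw].
  assert (Htot : avg d n total (fun _ => 0%nat) <= C0 + 1).
  { unfold total; rewrite avg_plus, avg_scal, avg_sumR by exact Hn.
    apply Rplus_le_compat.
    - apply Rle_trans with
        (sumR J (fun j => sumR d (fun k => (2 * 2 ^ m k + 2) * r k ^ j))).
      + apply sumR_le; intros j Hj; rewrite avg_sumR by exact Hn.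
        apply sumR_le; intros k Hk; apply avg_cost_le; auto.
      + rewrite sumR_swap; apply sumR_le; intros k Hk; rewrite sumR_scal.
        specialize (Hr k Hk).
        apply Rmult_le_compat_l; [pose proof (pow_lt 2 (m k)); lra|].
        apply sumR_geom_le; lra.
    - pose proof (avg_corner_le d a m J Hm Ha Hmass) as H.
      rewrite prodR_inv_pow2 in H; fold M in H.
      replace (- M * INR J) with (- (INR J * M)) in HJ by ring.
      apply Rmult_le_reg_l with delta; [exact Hdelta|].
      rewrite <- Rmult_assoc, Rinv_r, Rmult_1_l, Rmult_1_r by lra.
      apply Rle_trans with (1 := H); lra. }
  (* The path through the corners chosen by [w], built one scale after the other; at scale 0 the
     corner is the origin. *)
  assert (Hpath : forall J', exists c,
    lattice_path d a tau (fun i => corner m J' i (w i)) c /\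
    c <= sumR J' (fun j => sumR d (fun k => cost j k w))).
  { intros J'; induction J' as [|j [c [Hc Hle]]].
    - exists 0; split; [|simpl; lra].
      replace (fun i => corner m 0 i (w i)) with (fun _ : nat => 0%nat);
        [constructor|].
      apply functional_extensionality; intros i; unfold corner.
      rewrite Nat.mul_0_r; reflexivity.
    - destruct (lattice_path_splice d a tau _ (fun i => corner m (S j) i (w i)) c
        (fun k => (2 * 2 ^ (m k * S j))%nat) d (Nat.le_refl d)
        (fun i => corner_le m j i (w i)) Hc) as [c' [Hc' Hle']].
      exists c'; split.
      + replace (fun i => corner m (S j) i (w i)) with
          (splice d (fun i => corner m j i (w i)) (fun i => corner m (S j) i (w i)));
          [exact Hc'|].
        apply functional_extensionality; intros i; unfold splice.
        destruct (Nat.ltb_spec i d) as [|Hi]; [reflexivity|].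
        unfold corner; rewrite (Hm i Hi); reflexivity.
      + simpl; apply Rle_trans with (1 := Hle'), Rplus_le_compat; [exact Hle|].
        apply sumR_le; intros k Hk; unfold cost; apply sumR_le; intros x _.
        right; f_equal; f_equal; f_equal.
        apply functional_extensionality; intros i.
        unfold splice, corner_side; destruct (Nat.ltb i k); reflexivity. }
  destruct (Hpath J) as [c [Hc Hle]].
  exists (fun i => corner m J i (w i)), c; split; [exact Hc|].
  apply Rle_trans with (2 := Htot) in Hw; unfold total in Hw.
  set (aJ := a (fun i => corner m J i (w i))) in *.
  assert (HaJ : 0 < / delta * aJ)
    by (apply Rmult_lt_0_compat; [apply Rinv_0_lt_compat; lra|apply Ha]).
  split; [lra|].
  assert (Hcost : 0 <= sumR J (fun j => sumR d (fun k => cost j k w))).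
  { apply sumR_ge0; intros; apply sumR_ge0; intros; apply sumR_ge0; intros.
    left; apply Rpower_gt0. }
  assert (H : / delta * aJ <= C0 + 1) by lra.
  apply Rmult_le_compat_l with (r := delta) in H; [|lra].
  rewrite <- Rmult_assoc, Rinv_r, Rmult_1_l in H by lra.
  apply Rle_lt_trans with (1 := H).
  unfold delta; apply Rmult_lt_reg_r with (C0 + 2); [lra|].
  replace (eps / (C0 + 2) * (C0 + 1) * (C0 + 2)) with (eps * (C0 + 1)) by (field; lra).
  nra.
Qed.

(** * Disjoint intervals *)

(** Induction on a bound for the number of intervals: the first one separates the others into those
    on its left and those on its right, and each group fits in the room on its side. *)
Lemma sum_disjoint_intervals {A : Type} (l r : A -> R) (s : list A) lo hi :
  NoDup s -> lo <= hi ->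
  (forall i, In i s -> lo <= l i <= r i /\ r i <= hi) ->
  (forall i j, In i s -> In j s -> i <> j -> r i <= l j \/ r j <= l i) ->
  lsum s (fun i => r i - l i) <= hi - lo.
Proof.
  remember (length s) as n eqn:En.
  assert (Hn : (length s <= n)%nat) by lia; clear En.
  revert s lo hi Hn; induction n as [|n IH]; intros s lo hi Hn Hs Hlh Hin Hd.
  - destruct s; [simpl; lra|simpl in Hn; lia].
  - destruct s as [|i s]; [simpl; lra|].
    inversion_clear Hs as [|? ? Hi Hs']; simpl in Hn.
    set (p j := if Rle_dec (r j) (l i) then true else false).
    rewrite lsum_cons, (lsum_filter p).
    destruct (Hin i (or_introl eq_refl)) as [Hi1 Hi2].
    assert (Hlen : forall q, (length (filter q s) <= n)%nat)
      by (intros q; pose proof (filter_length_le q s); lia).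
    assert (H1 : lsum (filter p s) (fun i => r i - l i) <= l i - lo).
    { apply IH; auto; [apply NoDup_filter, Hs'|lra| |].
      - intros j Hj; apply filter_In in Hj; destruct Hj as [Hj Hp].
        unfold p in Hp; destruct (Rle_dec (r j) (l i)); [|discriminate].
        destruct (Hin j (or_intror Hj)); lra.
      - intros j k Hj Hk; apply filter_In in Hj, Hk; apply Hd; right; tauto. }
    assert (H2 : lsum (filter (fun j => negb (p j)) s) (fun i => r i - l i) <= hi - r i).
    { apply IH; auto; [apply NoDup_filter, Hs'| |].
      - intros j Hj; apply filter_In in Hj; destruct Hj as [Hj Hp].
        unfold p in Hp; destruct (Rle_dec (r j) (l i)); [discriminate|].
        destruct (Hin j (or_intror Hj)) as [Hj1 Hj2].
        assert (Hij : i <> j) by (intros ->; auto).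
        destruct (Hd i j (or_introl eq_refl) (or_intror Hj) Hij); lra.
      - intros j k Hj Hk; apply filter_In in Hj, Hk; apply Hd; right; tauto. }
    lra.
Qed.

(** Integer translations bring all left ends into [[0, 1)]; the arcs, of length at most 1, then lie
    in [[0, 2]], whence the bound 2. *)
Lemma sum_disjoint_arcs {A : Type} (l r : A -> R) (s : list A) :
  NoDup s ->
  (forall i, In i s -> l i <= r i <= l i + 1) ->
  (forall i j (m : Z), In i s -> In j s -> i <> j ->
     r i + IZR m <= l j \/ r j <= l i + IZR m) ->
  lsum s (fun i => r i - l i) <= 2.
Proof.
  intros Hs Hlr Hd.
  set (k i := IZR (Int_part (l i))).
  assert (Hk : forall i, 0 <= l i - k i < 1)
    by (intros i; pose proof (base_Int_part (l i)); unfold k; lra).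
  replace (fun i => r i - l i) with (fun i => (r i - k i) - (l i - k i))
    by (apply functional_extensionality; intros i; ring).
  replace 2 with (2 - 0) by ring.
  apply (sum_disjoint_intervals (fun i => l i - k i) (fun i => r i - k i));
    auto; [lra| |].
  - intros i Hi; specialize (Hk i); specialize (Hlr i Hi); lra.
  - intros i j Hi Hj Hij.
    destruct (Hd i j (Int_part (l j) - Int_part (l i))%Z Hi Hj Hij) as [H|H];
      rewrite minus_IZR in H; fold (k i) (k j) in H; lra.
Qed.

(** * Monotone maps of degree one *)

Definition monotone (F : R -> R) : Prop := forall x y, x <= y -> F x <= F y.

Lemma shift_IZR (g : R -> R) c :
  (forall x, g (x + 1) = g x + c) -> forall x m, g (x + IZR m) = g x + IZR m * c.
Proof.
  intros H.
  assert (Hn : forall n x, g (x + INR n) = g x + INR n * c).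
  { induction n as [|n IH]; intros x.
    - simpl; rewrite Rplus_0_r; ring.
    - rewrite S_INR, <- Rplus_assoc, H, IH; ring. }
  intros x m; destruct (Z.le_gt_cases 0 m) as [Hm|Hm].
  - rewrite <- (Z2Nat.id m Hm), <- INR_IZR_INZ; apply Hn.
  - specialize (Hn (Z.to_nat (- m)) (x + IZR m)).
    rewrite INR_IZR_INZ, Z2Nat.id, opp_IZR in Hn by lia.
    replace (x + IZR m + - IZR m) with x in Hn by ring; lra.
Qed.

Lemma degree_one_IZR F : degree_one F -> forall x m, F (x + IZR m) = F x + IZR m.
Proof. intros H x m; rewrite (shift_IZR F 1 H); ring. Qed.

Lemma floor_ex x : exists m : Z, IZR m <= x < IZR m + 1.
Proof. exists (Int_part x); pose proof (base_Int_part x); lra. Qed.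

Lemma displacement_bound F : degree_one F -> monotone F ->
  forall x, Rabs (F x - x - F 0) <= 1.
Proof.
  intros Hd Hm x; destruct (floor_ex x) as [m Hmx].
  pose proof (Hm (0 + IZR m) x) as H1.
  pose proof (Hm x (0 + IZR (m + 1))) as H2.
  rewrite (degree_one_IZR F Hd) in H1, H2; rewrite plus_IZR in H2.
  apply Rabs_le; lra.
Qed.

Lemma degree_one_iter F n : degree_one F -> degree_one (Nat.iter n F).
Proof. intros H; induction n as [|n IH]; intros x; simpl; [|rewrite IH, H]; reflexivity. Qed.

Lemma monotone_iter F n : monotone F -> monotone (Nat.iter n F).
Proof. intros H; induction n as [|n IH]; intros x y Hxy; simpl; auto. Qed.

Lemma iter_plus (F : R -> R) m n x :
  Nat.iter (m + n) F x = Nat.iter m F (Nat.iter n F x).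
Proof. induction m as [|m IH]; simpl; [|rewrite IH]; reflexivity. Qed.

Lemma iter_translate F (x : R) (g : R -> R) c :
  (forall y, g (F y) = g y + c) -> forall n, g (Nat.iter n F x) = g x + INR n * c.
Proof.
  intros H; induction n as [|n IH]; [simpl; ring|].
  rewrite S_INR; simpl; rewrite H, IH; ring.
Qed.

(** Poincaré's translation number, obtained as the supremum of [(F^n 0 - 1) / n]. As [F^(m n) 0] is
    within [m] of [m * F^n 0] and within [n] of [n * F^m 0], each of these quotients is at most
    every [(F^m 0 + 1) / m]. *)
Lemma translation_number_ex F : degree_one F -> monotone F ->
  exists r, forall n x, Rabs (Nat.iter n F x - x - INR n * r) <= 2.
Proof.
  intros Hd Hm.
  set (a n := Nat.iter n F 0).
  assert (Hdisp : forall n x, Rabs (Nat.iter n F x - x - a n) <= 1).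
  { intros n x; apply displacement_bound;
      [apply degree_one_iter, Hd|apply monotone_iter, Hm]. }
  assert (Hmul : forall n m, Rabs (a (m * n)%nat - INR m * a n) <= INR m).
  { intros n; induction m as [|m IH].
    - simpl; unfold a; simpl; rewrite Rmult_0_l, Rminus_0_r, Rabs_R0; lra.
    - replace (a (S m * n)%nat) with (Nat.iter n F (a (m * n)%nat))
        by (unfold a; rewrite <- iter_plus; reflexivity).
      specialize (Hdisp n (a (m * n)%nat)).
      apply Rabs_le_between in Hdisp, IH; rewrite S_INR; apply Rabs_le; lra. }
  assert (Hcross : forall n m, (0 < n)%nat -> (0 < m)%nat ->
    (a n - 1) / INR n <= (a m + 1) / INR m).
  { intros n m Hn0 Hm0.
    pose proof (Hmul n m) as H1; pose proof (Hmul m n) as H2.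
    rewrite Nat.mul_comm in H2.
    apply Rabs_le_between in H1, H2.
    assert (0 < INR n) by (apply lt_0_INR; lia).
    assert (0 < INR m) by (apply lt_0_INR; lia).
    apply Rmult_le_reg_r with (INR n * INR m); [apply Rmult_lt_0_compat; lra|].
    replace ((a n - 1) / INR n * (INR n * INR m)) with ((a n - 1) * INR m) by (field; lra).
    replace ((a m + 1) / INR m * (INR n * INR m)) with ((a m + 1) * INR n) by (field; lra).
    lra. }
  destruct (completeness (fun y => exists n, (0 < n)%nat /\ y = (a n - 1) / INR n))
    as [r [Hr1 Hr2]].
  { exists ((a 1%nat + 1) / INR 1); intros y [n [Hn ->]]; apply Hcross; lia. }
  { exists ((a 1%nat - 1) / INR 1), 1%nat; auto. }
  exists r; intros n x.
  assert (Hnr : Rabs (a n - INR n * r) <= 1).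
  { destruct n as [|n].
    - unfold a; simpl; rewrite Rmult_0_l, Rminus_0_r, Rabs_R0; lra.
    - assert (Hn : 0 < INR (S n)) by (apply lt_0_INR; lia).
      assert (H1 : (a (S n) - 1) / INR (S n) <= r)
        by (apply Hr1; exists (S n); split; [lia|reflexivity]).
      assert (H2 : r <= (a (S n) + 1) / INR (S n))
        by (apply Hr2; intros y [k [Hk ->]]; apply Hcross; lia).
      apply Rmult_le_compat_r with (r := INR (S n)) in H1; [|lra].
      apply Rmult_le_compat_r with (r := INR (S n)) in H2; [|lra].
      unfold Rdiv in H1, H2; rewrite Rmult_assoc, Rinv_l, Rmult_1_r in H1, H2 by lra.
      apply Rabs_le; lra. }
  specialize (Hdisp n x); apply Rabs_le_between in Hdisp, Hnr; apply Rabs_le; lra.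
Qed.

(** The integer by which [F G] and [G F] differ is constant by continuity, say [m]. Then [F G^n] and
    [G^n F] differ by [n m] at 0, while displacement bounds keep this difference within 2, so
    [m = 0]. *)
Lemma lifts_commute F G :
  degree_one F -> monotone F -> (forall x, continuous F x) ->
  degree_one G -> monotone G -> (forall x, continuous G x) ->
  circle_commute F G -> forall x, F (G x) = G (F x).
Proof.
  intros HF HFm HFc HG HGm HGc Hcom.
  destruct (Hcom 0) as [m Hm0].
  assert (Hm : forall x, F (G x) = G (F x) + IZR m).
  { intros x; destruct (Hcom x) as [p Hp].
    destruct (Z.eq_dec p m) as [->|Hpm]; [exact Hp|exfalso].
    set (D x := F (G x) - G (F x)).
    assert (HD : continuity D).
    { intros y; apply continuity_pt_filterlim.
      apply (continuous_minus (fun y => F (G y)) (fun y => G (F y)));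
        apply continuous_comp; auto. }
    assert (HDx : D x = IZR p) by (unfold D; lra).
    assert (HD0 : D 0 = IZR m) by (unfold D; lra).
    (* If two integer values occurred, the half-integer [q + 1/2] would be attained in between. *)
    set (q := Z.min p m).
    destruct (IVT_gen D x 0 (IZR q + / 2) HD) as [z [_ Hz]].
    - rewrite HDx, HD0; unfold q.
      destruct (Z.lt_ge_cases p m) as [H|H].
      + assert (IZR p + 1 <= IZR m) by (rewrite <- plus_IZR; apply IZR_le; lia).
        rewrite Z.min_l, Rmin_left, Rmax_right by (lia || lra); lra.
      + assert (IZR m + 1 <= IZR p) by (rewrite <- plus_IZR; apply IZR_le; lia).
        rewrite Z.min_r, Rmin_right, Rmax_left by (lia || lra); lra.
    - destruct (Hcom z) as [k Hk]; unfold D in Hz.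
      assert (H1 : IZR q < IZR k) by lra.
      assert (H2 : IZR k < IZR (q + 1)) by (rewrite plus_IZR; lra).
      apply lt_IZR in H1, H2; lia. }
  assert (Hn : forall n, F (Nat.iter n G 0) = Nat.iter n G (F 0) + INR n * IZR m).
  { induction n as [|n IH]; [simpl; ring|].
    rewrite S_INR; simpl; rewrite Hm, IH.
    rewrite INR_IZR_INZ, <- mult_IZR, (degree_one_IZR G HG), mult_IZR; ring. }
  assert (Hb : forall n, Rabs (INR n * IZR m) <= 2).
  { intros n; specialize (Hn n).
    pose proof (displacement_bound F HF HFm (Nat.iter n G 0)) as H1.
    pose proof (displacement_bound _ (degree_one_iter G n HG) (monotone_iter G n HGm) (F 0)) as H2.
    apply Rabs_le_between in H1, H2; apply Rabs_le; lra. }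
  assert (Em : m = 0%Z).
  { specialize (Hb 3%nat); apply Rabs_le_between in Hb.
    replace (INR 3) with 3 in Hb by (simpl; ring).
    assert (-1 < IZR m < 1) as [H1 H2] by lra.
    apply lt_IZR in H1, H2; lia. }
  intros x; rewrite Hm, Em; ring.
Qed.

(** * The semiconjugacy *)

(** Boundedness excludes the infinite values, which [real] would send to its default 0. *)
Lemma is_LimSup_bounded u lo hi :
  (forall n, lo <= u n <= hi) -> is_LimSup_seq u (Finite (real (LimSup_seq u))).
Proof.
  intros Hu; destruct (ex_LimSup_seq u) as [l Hl].
  rewrite (is_LimSup_seq_unique u l Hl).
  destruct l as [l| |]; [exact Hl| |]; exfalso.
  - destruct (Hl hi 0%nat) as [n [_ Hn]]; specialize (Hu n); lra.
  - destruct (Hl lo) as [n Hn]; specialize (Hu n); specialize (Hn n (Nat.le_refl n)); lra.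
Qed.

Lemma is_LimSup_seq_translate u l c :
  is_LimSup_seq u (Finite l) -> is_LimSup_seq (fun n => u n + c) (Finite (l + c)).
Proof.
  intros Hl eps; destruct (Hl eps) as [H1 [N H2]]; split.
  - intros M; destruct (H1 M) as [n [Hn Hu]]; exists n; split; [exact Hn|simpl in *; lra].
  - exists N; intros n Hn; specialize (H2 n Hn); simpl in *; lra.
Qed.

(** The maps are added one at a time. If [Phi] works for the first ones and [r] is the translation
    number of [F d], the upper limit of [Phi (F_d^n x) - n r] is finite, inherits the earlier
    relations by commutation, and is translated by [r] under [F d] because an upper limit ignores a
    shift of the index. *)
Lemma semiconjugacy_ex d F :
  (forall k, (k < d)%nat -> degree_one (F k) /\ monotone (F k)) ->
  (forall j k x, (j < d)%nat -> (k < d)%nat -> F j (F k x) = F k (F j x)) ->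
  exists Phi (rho : nat -> R), degree_one Phi /\ monotone Phi /\
    forall k x, (k < d)%nat -> Phi (F k x) = Phi x + rho k.
Proof.
  induction d as [|d IH]; intros HF Hcom.
  - exists (fun x => x), (fun _ => 0).
    split; [intros x; reflexivity|split; [intros x y Hxy; exact Hxy|intros; lia]].
  - destruct IH as [Phi [rho [HP [HPm HPr]]]]; [intros; apply HF; lia|intros; apply Hcom; lia|].
    destruct (HF d) as [Hd Hm]; [lia|].
    destruct (translation_number_ex (F d) Hd Hm) as [r Hr].
    set (u x n := Phi (Nat.iter n (F d) x) + - (INR n * r)).
    set (Psi x := real (LimSup_seq (u x))).
    assert (Hu : forall x n, x + Phi 0 - 3 <= u x n <= x + Phi 0 + 3).
    { intros x n; specialize (Hr n x).
      pose proof (displacement_bound Phi HP HPm (Nat.iter n (F d) x)) as H.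
      apply Rabs_le_between in Hr, H; unfold u; lra. }
    assert (HL : forall x, is_LimSup_seq (u x) (Finite (Psi x)))
      by (intros x; apply is_LimSup_bounded with (1 := Hu x)).
    assert (Htr : forall x y c, (forall n, u y n = u x n + c) -> Psi y = Psi x + c).
    { intros x y c H; unfold Psi at 1.
      rewrite (is_LimSup_seq_unique (u y) (Finite (Psi x + c))); [reflexivity|].
      apply is_LimSup_seq_ext with (fun n => u x n + c); [auto|].
      apply is_LimSup_seq_translate, HL. }
    exists Psi, (fun k => if Nat.eqb k d then r else rho k); split; [|split].
    + intros x; apply Htr; intros n; unfold u.
      rewrite (degree_one_iter _ n Hd), HP; ring.
    + intros x y Hxy.
      assert (H : Rbar_le (LimSup_seq (u x)) (LimSup_seq (u y))).
      { apply LimSup_le; exists 0%nat; intros n _; unfold u.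
        apply Rplus_le_compat_r, HPm, monotone_iter; assumption. }
      rewrite (is_LimSup_seq_unique _ _ (HL x)), (is_LimSup_seq_unique _ _ (HL y)) in H.
      exact H.
    + intros k x Hk; destruct (Nat.eqb_spec k d) as [->|Hkd].
      * unfold Psi at 1.
        rewrite (is_LimSup_seq_unique (u (F d x)) (Finite (Psi x + r))); [reflexivity|].
        apply is_LimSup_seq_ext with (fun n => u x (S n) + r).
        { intros n; unfold u; rewrite S_INR, Nat.iter_succ_r; ring. }
        apply is_LimSup_seq_translate, (is_LimSup_seq_ind_1 (u x)), HL.
      * apply Htr; intros n; unfold u.
        assert (E : Nat.iter n (F d) (F k x) = F k (Nat.iter n (F d) x)).
        { clear Hu; induction n as [|n IHn]; simpl; [reflexivity|].
          rewrite IHn; apply Hcom; lia. }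
        rewrite E, HPr by lia; ring.
Qed.

(** [Phi] differs from a translation by at most 1 and turns [F^n] into the translation by [n r], so
    [F^n 0] stays within 1 of [n r]. *)
Lemma rot_num_semiconjugacy F Phi r :
  degree_one Phi -> monotone Phi -> (forall x, Phi (F x) = Phi x + r) ->
  rot_num F = r.
Proof.
  intros HP HPm HPr; unfold rot_num.
  assert (Hb : forall n, Rabs (Nat.iter n F 0 - INR n * r) <= 1).
  { intros n; pose proof (displacement_bound Phi HP HPm (Nat.iter n F 0)) as H.
    rewrite (iter_translate F 0 Phi r HPr) in H.
    apply Rabs_le_between in H; apply Rabs_le; lra. }
  assert (Hz : is_lim_seq (fun n => / INR (S n)) 0).
  { apply (is_lim_seq_incr_1 (fun n => / INR n)).
    apply (is_lim_seq_inv INR p_infty); [apply is_lim_seq_INR|discriminate]. }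
  rewrite (is_lim_seq_unique _ (Finite r)); [reflexivity|].
  apply is_lim_seq_le_le with (fun n => r + - / INR (S n)) (fun n => r + / INR (S n)).
  - intros n; specialize (Hb (S n)); apply Rabs_le_between in Hb.
    assert (H : 0 < INR (S n)) by (apply lt_0_INR; lia).
    split; apply Rmult_le_reg_r with (INR (S n)); auto; unfold Rdiv;
      rewrite Rmult_assoc, Rinv_l, Rmult_plus_distr_r, ?Ropp_mult_distr_l_reverse, ?Rinv_l; lra.
  - replace (Finite r) with (Finite (r + - 0)) by (f_equal; ring).
    apply is_lim_seq_plus'; [apply is_lim_seq_const|apply is_lim_seq_opp in Hz; exact Hz].
  - replace (Finite r) with (Finite (r + 0)) by (f_equal; ring).
    apply is_lim_seq_plus'; [apply is_lim_seq_const|exact Hz].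
Qed.

(** When [l < r], the only value of [Phi] that can lie strictly between [l] and [r] is the one at
    [x] itself. *)
Definition jump (Phi : R -> R) (x l r : R) : Prop :=
  (forall z, z < x -> Phi z <= l) /\ (forall y, x < y -> r <= Phi y).

(* A jump of [Phi] at [x] reappears with the same size at every [F^n x]. *)
Lemma semiconjugacy_continuous F Phi r :
  degree_one F -> (forall x y, x < y -> F x < F y) -> (forall x, continuous F x) ->
  degree_one Phi -> monotone Phi -> (forall x, Phi (F x) = Phi x + r) ->
  (forall i j (m : Z), i <> j -> INR i * r + IZR m <> INR j * r) ->
  forall x, continuous Phi x.
Proof.
  intros HF HFi HFc HP HPm HPr Hirr x0.
  assert (HPn := fun x => iter_translate F x Phi r HPr).
  assert (Hstep : forall x l r', jump Phi x l r' -> jump Phi (F x) (l + r) (r' + r)).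
  { intros x l r' [H1 H2].
    assert (Hc : forall eps, 0 < eps -> exists t, 0 < t /\
      forall y, Rabs (y - x) < t -> Rabs (F y - F x) < eps).
    { intros eps Heps.
      destruct (proj1 (filterlim_locally _ _) (HFc x) (mkposreal eps Heps)) as [t Ht].
      exists t; split; [apply cond_pos|exact Ht]. }
    split.
    - intros z Hz; destruct (Hc (F x - z)) as [t [Ht Hy]]; [lra|].
      specialize (Hy (x - t / 2)); replace (x - t / 2 - x) with (- (t / 2)) in Hy by ring.
      rewrite Rabs_Ropp, Rabs_pos_eq in Hy by lra.
      assert (Hy' := Hy ltac:(lra)); apply Rabs_lt_between in Hy'.
      apply Rle_trans with (Phi (F (x - t / 2))); [apply HPm; lra|].
      rewrite HPr; apply Rplus_le_compat_r, H1; lra.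
    - intros z Hz; destruct (Hc (z - F x)) as [t [Ht Hy]]; [lra|].
      specialize (Hy (x + t / 2)); replace (x + t / 2 - x) with (t / 2) in Hy by ring.
      rewrite Rabs_pos_eq in Hy by lra.
      assert (Hy' := Hy ltac:(lra)); apply Rabs_lt_between in Hy'.
      apply Rle_trans with (Phi (F (x + t / 2))); [|apply HPm; lra].
      rewrite HPr; apply Rplus_le_compat_r, H2; lra. }
  assert (Hjump : forall l r', jump Phi x0 l r' -> r' <= l).
  { intros l r' Hj; apply Rnot_lt_le; intros Hlt.
    assert (Hn : forall n, jump Phi (Nat.iter n F x0) (l + INR n * r) (r' + INR n * r)).
    { induction n as [|n IH].
      - simpl; rewrite Rmult_0_l, !Rplus_0_r; exact Hj.
      - apply Hstep in IH; rewrite S_INR; simpl.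
        replace (l + (INR n + 1) * r) with (l + INR n * r + r) by ring.
        replace (r' + (INR n + 1) * r) with (r' + INR n * r + r) by ring.
        exact IH. }
    (* The gaps at the points of the orbit are disjoint modulo 1 and all have length [r' - l], so
       their number is bounded unless this length vanishes. *)
    assert (Hsum : forall N, INR N * (r' - l) <= 2).
    { intros N; rewrite <- (length_seq N 0) at 1; rewrite <- lsum_const.
      replace (fun _ : nat => r' - l)
        with (fun n => (r' + INR n * r) - (l + INR n * r))
        by (apply functional_extensionality; intros; ring).
      apply (sum_disjoint_arcs (fun n => l + INR n * r) (fun n => r' + INR n * r));
        [apply seq_NoDup| |].
      - intros n _; destruct Hj as [H1 H2].
        specialize (H1 (x0 - / 2)); specialize (H2 (x0 - / 2 + 1)).
        rewrite HP in H2; lra.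
      - intros i j m _ _ Hij.
        destruct (Hn i) as [Hi1 Hi2], (Hn j) as [Hj1 Hj2].
        set (xi := Nat.iter i F x0) in *; set (xj := Nat.iter j F x0) in *.
        destruct (Rtotal_order (xi + IZR m) xj) as [H|[H|H]].
        + left; set (y := (xi + IZR m + xj) / 2).
          assert (Ey : Phi y = Phi (y - IZR m) + IZR m).
          { rewrite <- (degree_one_IZR Phi HP); f_equal; ring. }
          specialize (Hi2 (y - IZR m)); specialize (Hj1 y); unfold y in *; lra.
        + exfalso; apply (Hirr i j m Hij).
          pose proof (HPn x0 i) as Ei; pose proof (HPn x0 j) as Ej.
          fold xi in Ei; fold xj in Ej.
          rewrite <- H, (degree_one_IZR Phi HP) in Ej; lra.
        + right; set (y := (xi + IZR m + xj) / 2).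
          assert (Ey : Phi y = Phi (y - IZR m) + IZR m).
          { rewrite <- (degree_one_IZR Phi HP); f_equal; ring. }
          specialize (Hi1 (y - IZR m)); specialize (Hj2 y); unfold y in *; lra. }
    destruct (nfloor_ex (2 / (r' - l))) as [N HN].
    { left; apply Rdiv_lt_0_compat; lra. }
    specialize (Hsum (S N)); rewrite S_INR in Hsum.
    assert (H : 2 / (r' - l) * (r' - l) < (INR N + 1) * (r' - l))
      by (apply Rmult_lt_compat_r; lra).
    unfold Rdiv in H; rewrite Rmult_assoc, Rinv_l in H by lra; lra. }
  apply filterlim_locally; intros eps; destruct eps as [eps Heps].
  (* Failure of left continuity would be a jump from [Phi x0 - eps] to [Phi x0]; the right side is
     symmetric. *)
  assert (Hl : exists z, z < x0 /\ Phi x0 - eps < Phi z).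
  { apply NNPP; intros H.
    assert (Phi x0 <= Phi x0 - eps); [|lra].
    apply Hjump; split.
    - intros z Hz; apply Rnot_lt_le; intros Hz'; apply H; exists z; auto.
    - intros y Hy; apply HPm; lra. }
  assert (Hr : exists y, x0 < y /\ Phi y < Phi x0 + eps).
  { apply NNPP; intros H.
    assert (Phi x0 + eps <= Phi x0); [|lra].
    apply Hjump; split.
    - intros z Hz; apply HPm; lra.
    - intros y Hy; apply Rnot_lt_le; intros Hy'; apply H; exists y; auto. }
  destruct Hl as [z [Hz1 Hz2]], Hr as [y [Hy1 Hy2]].
  assert (Ht : 0 < Rmin (x0 - z) (y - x0)) by (apply Rmin_glb_lt; lra).
  exists (mkposreal _ Ht); intros t Hball.
  assert (Habs : Rabs (t - x0) < Rmin (x0 - z) (y - x0)) by exact Hball.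
  pose proof (Rmin_l (x0 - z) (y - x0)); pose proof (Rmin_r (x0 - z) (y - x0)).
  apply Rabs_lt_between in Habs.
  assert (Phi z <= Phi t) by (apply HPm; lra).
  assert (Phi t <= Phi y) by (apply HPm; lra).
  change (Rabs (Phi t - Phi x0) < eps); apply Rabs_lt_between; lra.
Qed.

(** * Uniform continuity and distortion estimates *)

Lemma degree_one_uniformly_continuous Phi :
  degree_one Phi -> (forall x, continuous Phi x) ->
  forall eps, 0 < eps -> exists delta, 0 < delta /\
    forall x y, x <= y < x + delta -> Phi y < Phi x + eps.
Proof.
  intros HP HPc eps Heps.
  destruct (@Heine_cor2 Phi 0 2
    (fun x _ => proj2 (continuity_pt_filterlim Phi x) (HPc x)) (mkposreal eps Heps))
    as [delta Hdelta].
  (* With [delta <= 1], an integer translation moves both points into [[0, 2]], where compactness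
     applies. *)
  exists (Rmin delta 1); split; [apply Rmin_glb_lt; [apply cond_pos|lra]|].
  intros x y Hxy.
  pose proof (Rmin_l delta 1); pose proof (Rmin_r delta 1).
  destruct (floor_ex x) as [m Hm].
  specialize (Hdelta (x - IZR m) (y - IZR m)); simpl in Hdelta.
  assert (H1 : Rabs (x - IZR m - (y - IZR m)) < delta) by (apply Rabs_lt_between; lra).
  specialize (Hdelta ltac:(lra) ltac:(lra) H1); apply Rabs_lt_between in Hdelta.
  pose proof (degree_one_IZR Phi HP (x - IZR m) m) as Ex.
  pose proof (degree_one_IZR Phi HP (y - IZR m) m) as Ey.
  replace (x - IZR m + IZR m) with x in Ex by ring.
  replace (y - IZR m + IZR m) with y in Ey by ring.
  lra.
Qed.

Lemma circle_diffeo_homeo tau F : circle_diffeo_C1tau tau F -> circle_homeo_lift F.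
Proof.
  intros [HF [DF [HD [_ [Hpos _]]]]]; split; [exact HF|split].
  - intros x; apply (ex_derive_continuous F); exists (DF x); apply HD.
  - intros x y Hxy.
    apply (incr_function F m_infty p_infty DF); simpl; auto.
    intros; apply Hpos.
Qed.

Lemma homeo_monotone F : circle_homeo_lift F -> monotone F.
Proof.
  intros [_ [_ H]] x y [Hxy| ->]; [left; apply H, Hxy|apply Rle_refl].
Qed.

Lemma exp_monotone : monotone exp.
Proof. intros x y [H| ->]; [left; apply exp_increasing, H|apply Rle_refl]. Qed.

(** The ratio of the lengths of [[y, z]] and [[x, y]] grows under [F] by a quotient of two values of
    the derivative, by the mean value theorem. The Hölder condition and a positive lower bound of
    the derivative control this quotient. The inequality is cleared of denominators. *)
Lemma distortion tau F : 0 < tau -> circle_diffeo_C1tau tau F ->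
  exists K, 0 <= K /\ forall x y z, x < y -> y < z ->
    (F z - F y) * (y - x)
    <= (F y - F x) * (z - y) * exp (K * Rpower (z - x) tau).
Proof.
  intros Htau [HF [DF [HD [HDc [Hpos [C HC]]]]]].
  assert (HD1 : forall x, DF (x + 1) = DF x + 0).
  { intros x; rewrite Rplus_0_r.
    rewrite <- (is_derive_unique F x (DF x) (HD x)).
    symmetry; apply is_derive_unique.
    apply is_derive_ext with (fun t => F (t + 1) - 1);
      [intros t; rewrite HF; simpl; ring|].
    auto_derive; [exists (DF (x + 1)); apply HD|].
    rewrite Rmult_1_l; apply is_derive_unique, HD. }
  (* The minimum over one period bounds the periodic function [DF] from below everywhere. *)
  destruct (continuity_ab_min DF 0 1) as [x0 [Hmin _]]; [lra| |].
  { intros c _; apply continuity_pt_filterlim, HDc. }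
  set (kappa := DF x0) in *.
  assert (Hk : 0 < kappa) by apply Hpos.
  assert (Hmin' : forall x, kappa <= DF x).
  { intros x; destruct (floor_ex x) as [m Hm].
    replace x with (x - IZR m + IZR m) by ring.
    rewrite (shift_IZR DF 0 HD1), Rmult_0_r, Rplus_0_r.
    apply Hmin; lra. }
  exists (Rabs C / kappa); split.
  { apply Rmult_le_pos; [apply Rabs_pos|left; apply Rinv_0_lt_compat, Hk]. }
  intros x y z Hxy Hyz.
  destruct (MVT_cor2 F DF x y Hxy) as [u [Hu1 Hu2]];
    [intros c _; apply is_derive_Reals, HD|].
  destruct (MVT_cor2 F DF y z Hyz) as [v [Hv1 Hv2]];
    [intros c _; apply is_derive_Reals, HD|].
  rewrite Hu1, Hv1.
  set (q := Rpower (z - x) tau).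
  assert (Hq : 0 < q) by apply Rpower_gt0.
  assert (Hdiff : DF v - DF u <= Rabs C * q).
  { apply Rle_trans with (1 := Rle_abs _), Rle_trans with (1 := HC v u).
    pose proof (Rpower_gt0 (Rabs (v - u)) tau).
    apply Rle_trans with (Rabs C * Rpower (Rabs (v - u)) tau).
    - apply Rmult_le_compat_r; [lra|apply Rle_abs].
    - apply Rmult_le_compat_l; [apply Rabs_pos|].
      rewrite Rabs_pos_eq by lra; apply Rle_Rpower_l; lra. }
  assert (Hexp : DF v <= DF u * exp (Rabs C / kappa * q)).
  { pose proof (exp_ineq1_le (Rabs C / kappa * q)) as He.
    apply Rle_trans with (DF u * (1 + Rabs C / kappa * q));
      [|apply Rmult_le_compat_l; [left; apply Hpos|exact He]].
    assert (kappa * (Rabs C / kappa * q) <= DF u * (Rabs C / kappa * q)).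
    { apply Rmult_le_compat_r; [|apply Hmin'].
      pose proof (Rabs_pos C); apply Rmult_le_pos; [|lra].
      apply Rmult_le_pos; [lra|left; apply Rinv_0_lt_compat, Hk]. }
    replace (kappa * (Rabs C / kappa * q)) with (Rabs C * q) in H by (field; lra).
    lra. }
  apply Rle_trans with (DF u * exp (Rabs C / kappa * q) * (z - y) * (y - x)).
  - apply Rmult_le_compat_r; [lra|]; apply Rmult_le_compat_r; [lra|exact Hexp].
  - right; ring.
Qed.

(** * The action of the semigroup *)

(** The element [F^v] of the semigroup generated by the maps; only the coordinates of [v] below [d]
    are read. *)
Fixpoint word (F : nat -> R -> R) (d : nat) (v : nat -> nat) (x : R) : R :=
  match d with
  | O => x
  | S k => Nat.iter (v k) (F k) (word F k v x)
  end.

Lemma word_increasing F d v :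
  (forall k, (k < d)%nat -> circle_homeo_lift (F k)) ->
  forall x y, x < y -> word F d v x < word F d v y.
Proof.
  intros HF; induction d as [|d IH]; simpl; intros x y Hxy; [exact Hxy|].
  assert (H : word F d v x < word F d v y) by (apply IH; auto).
  destruct (HF d) as [_ [_ Hi]]; [lia|].
  induction (v d) as [|n IHn]; simpl; auto.
Qed.

Lemma word_degree_one F d v :
  (forall k, (k < d)%nat -> circle_homeo_lift (F k)) -> degree_one (word F d v).
Proof.
  intros HF; induction d as [|d IH]; intros x; simpl; [reflexivity|].
  rewrite IH by auto; apply degree_one_iter, HF; lia.
Qed.

Lemma word_semiconjugacy F d v Phi rho :
  (forall k x, (k < d)%nat -> Phi (F k x) = Phi x + rho k) ->
  forall x, Phi (word F d v x) = Phi x + sumR d (fun k => INR (v k) * rho k).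
Proof.
  intros HP x; induction d as [|d IH]; simpl; [ring|].
  rewrite (iter_translate (F d) _ Phi (rho d)) by (intros; apply HP; lia).
  rewrite IH by auto; ring.
Qed.

Lemma word_ext F d v w : (forall i, (i < d)%nat -> v i = w i) ->
  forall x, word F d v x = word F d w x.
Proof.
  intros H x; induction d as [|d IH]; simpl; [reflexivity|].
  rewrite IH, H; auto.
Qed.

(** By commutation the extra factor [F k] passes through the maps applied after it. *)
Lemma word_step F d v k :
  (forall i j x, (i < d)%nat -> (j < d)%nat -> F i (F j x) = F j (F i x)) ->
  (k < d)%nat ->
  forall x, word F d (upd v k (S (v k))) x = F k (word F d v x).
Proof.
  intros Hcom Hk x; induction d as [|d IH]; [lia|]; simpl.
  destruct (Nat.eq_dec k d) as [->|Hkd].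
  - rewrite upd_same; simpl; f_equal; f_equal.
    apply word_ext; intros i Hi; apply upd_other; lia.
  - rewrite upd_other by lia; rewrite IH by (auto; lia).
    induction (v d) as [|n IHn]; simpl; [reflexivity|].
    rewrite IHn; apply Hcom; lia.
Qed.

(** Independence is applied to the integers [v k - w k], whose combination equals the integer
    [- m]. *)
Lemma independent_combinations d rho v w (m : Z) :
  rationally_independent d rho ->
  sumR d (fun k => INR (v k) * rho k) + IZR m = sumR d (fun k => INR (w k) * rho k) ->
  forall k, (k < d)%nat -> v k = w k.
Proof.
  intros Hind E k Hk.
  assert (H : inject_Z (Z.of_nat (v k) - Z.of_nat (w k)) == 0%Q).
  { apply (Hind (fun k => inject_Z (Z.of_nat (v k) - Z.of_nat (w k)))); [|exact Hk].
    exists (inject_Z (- m)).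
    assert (EQ : forall z, Q2R (inject_Z z) = IZR z)
      by (intros z; unfold Q2R; simpl; field).
    rewrite EQ, opp_IZR.
    rewrite (sumR_ext d _ (fun k => INR (v k) * rho k + - 1 * (INR (w k) * rho k))).
    - rewrite sumR_plus, sumR_scal; lra.
    - intros i _; rewrite EQ, minus_IZR, <- !INR_IZR_INZ; ring. }
  unfold Qeq in H; simpl in H; lia.
Qed.

Lemma uniform_distortion d tau F :
  (forall k, (k < d)%nat -> 0 < tau k < 1) ->
  (forall k, (k < d)%nat -> circle_diffeo_C1tau (tau k) (F k)) ->
  exists K, 0 <= K /\ forall k x y z, (k < d)%nat -> x < y -> y < z ->
    (F k z - F k y) * (y - x)
    <= (F k y - F k x) * (z - y) * exp (K * Rpower (z - x) (tau k)).
Proof.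
  induction d as [|d IH]; intros Htau HF.
  - exists 0; split; [lra|intros; lia].
  - destruct IH as [K1 [HK1 H1]]; [auto|auto|].
    destruct (distortion (tau d) (F d)) as [K2 [HK2 H2]]; [apply Htau; lia|apply HF; lia|].
    exists (K1 + K2); split; [lra|]; intros k x y z Hk Hxy Hyz.
    assert (Hi : F k x < F k y)
      by (apply (proj2 (proj2 (circle_diffeo_homeo _ _ (HF k Hk)))); exact Hxy).
    pose proof (Rpower_gt0 (z - x) (tau k)) as Hp.
    assert (Hup : forall K, K <= K1 + K2 ->
      (F k y - F k x) * (z - y) * exp (K * Rpower (z - x) (tau k)) <=
      (F k y - F k x) * (z - y) * exp ((K1 + K2) * Rpower (z - x) (tau k))).
    { intros K HK; apply Rmult_le_compat_l; [apply Rmult_le_pos; lra|].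
      apply exp_monotone, Rmult_le_compat_r; lra. }
    destruct (Nat.eq_dec k d) as [->|Hkd].
    + apply Rle_trans with (1 := H2 x y z Hxy Hyz), Hup; lra.
    + assert (Hk' : (k < d)%nat) by lia.
      apply Rle_trans with (1 := H1 k x y z Hk' Hxy Hyz), Hup; lra.
Qed.

(* As long as the image of [[b, b']] is no longer than that of [[a, b]], one step of cost
   [|image of [a, b]|^tau] multiplies the ratio of the lengths by at most [exp (2 K cost)]. *)
Lemma lattice_path_ratio d tau F K C a b b' :
  (forall k, (k < d)%nat -> 0 < tau k < 1) ->
  (forall k, (k < d)%nat -> circle_homeo_lift (F k)) ->
  (forall i j x, (i < d)%nat -> (j < d)%nat -> F i (F j x) = F j (F i x)) ->
  0 <= K ->
  (forall k x y z, (k < d)%nat -> x < y -> y < z ->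
    (F k z - F k y) * (y - x)
    <= (F k y - F k x) * (z - y) * exp (K * Rpower (z - x) (tau k))) ->
  a < b < b' -> (b' - b) * exp (2 * K * C) <= b - a ->
  forall v c,
    lattice_path d (fun v => word F d v b - word F d v a) tau v c -> c <= C ->
    (word F d v b' - word F d v b) * exp (2 * K * (C - c))
      <= word F d v b - word F d v a.
Proof.
  intros Htau HF Hcom HK Hdist Hab Hb' v c Hpath.
  induction Hpath as [|v c k Hk Hpath IH]; intros HcC.
  - assert (E0 : forall x, word F d (fun _ => 0%nat) x = x)
      by (intros x; clear; induction d; simpl; auto).
    rewrite !E0, Rminus_0_r; exact Hb'.
  - rewrite !word_step by assumption.
    set (x := word F d v a) in *; set (y := word F d v b) in *;
    set (z := word F d v b') in *.
    assert (Hxy : x < y) by (apply word_increasing; [exact HF|lra]).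
    assert (Hyz : y < z) by (apply word_increasing; [exact HF|lra]).
    set (p := Rpower (y - x) (tau k)) in *.
    assert (Hp : 0 < p) by apply Rpower_gt0.
    assert (HcC' : c <= C) by lra.
    specialize (IH HcC').
    (* As [c <= C], the exponential in the induction hypothesis is at least 1, so the adjacent image
       is still the shorter one. *)
    assert (Hzx : z - y <= y - x).
    { apply Rle_trans with (2 := IH).
      rewrite <- (Rmult_1_r (z - y)) at 1; apply Rmult_le_compat_l; [lra|].
      rewrite <- exp_0; apply exp_monotone; apply Rmult_le_pos; lra. }
    (* Both images together have length at most [2 (y - x)], and [2^(tau k) <= 2]; this is the
       factor 2 in [2 * K]. *)
    assert (Hpow : Rpower (z - x) (tau k) <= 2 * p).
    { apply Rle_trans with (Rpower (2 * (y - x)) (tau k)).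
      - apply Rle_Rpower_l; [left; apply Htau, Hk|lra].
      - rewrite <- Rpower_mult_distr by lra.
        apply Rmult_le_compat_r; [lra|].
        rewrite <- (Rpower_1 2) at 2 by lra.
        apply Rle_Rpower; [lra|left; apply Htau, Hk]. }
    specialize (Hdist k x y z Hk Hxy Hyz).
    assert (HFxy : F k x < F k y) by (apply HF; auto).
    set (E := exp (2 * K * (C - (c + p)))).
    assert (HE : 0 < E) by apply exp_pos.
    assert (E1 : exp (2 * K * (C - c)) = E * exp (2 * K * p)).
    { unfold E; rewrite <- exp_plus; f_equal; ring. }
    rewrite E1 in IH.
    apply Rmult_le_reg_r with (y - x); [lra|].
    apply Rle_trans with ((F k y - F k x) * (z - y) * exp (2 * K * p) * E).
    + replace ((F k z - F k y) * E * (y - x)) with ((F k z - F k y) * (y - x) * E) by ring.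
      apply Rmult_le_compat_r; [lra|].
      apply Rle_trans with (1 := Hdist), Rmult_le_compat_l; [apply Rmult_le_pos; lra|].
      apply exp_monotone; replace (2 * K * p) with (K * (2 * p)) by ring.
      apply Rmult_le_compat_l; assumption.
    + replace ((F k y - F k x) * (z - y) * exp (2 * K * p) * E)
        with ((F k y - F k x) * ((z - y) * (E * exp (2 * K * p)))) by ring.
      apply Rmult_le_compat_l; [lra|exact IH].
Qed.

(** * Plateaus of the semiconjugacy and their exclusion *)

Lemma plateau_ex Phi x y :
  degree_one Phi -> monotone Phi -> (forall t, continuous Phi t) ->
  x < y -> Phi x = Phi y ->
  exists b, x < b <= x + 1 /\ Phi b = Phi x /\ forall z, b < z -> Phi x < Phi z.
Proof.
  intros HP HPm HPc Hxy Exy.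
  assert (Hub : forall t, Phi t = Phi x -> t <= x + 1).
  { intros t Ht; apply Rnot_lt_le; intros H.
    assert (Phi (x + 1) <= Phi t) by (apply HPm; lra).
    rewrite HP in H0; lra. }
  (* [b] is the supremum of the fibre of [Phi x]. If [Phi b] were larger than [Phi x], so would be
     [Phi] near [b], and a smaller number would bound the fibre. *)
  destruct (completeness (fun t => Phi t = Phi x)) as [b [Hb1 Hb2]].
  { exists (x + 1); intros t Ht; apply Hub, Ht. }
  { exists x; reflexivity. }
  assert (Hxb : x < b).
  { apply Rlt_le_trans with y; [exact Hxy|apply Hb1; auto]. }
  assert (Hbub : b <= x + 1) by (apply Hb2; intros t Ht; apply Hub, Ht).
  assert (Hz : forall z, b < z -> Phi x < Phi z).
  { intros z Hz; destruct (HPm x z) as [H|H]; [lra|exact H|exfalso].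
    assert (z <= b) by (apply Hb1; auto); lra. }
  exists b; repeat split; auto.
  apply Rle_antisym; [|apply HPm; lra].
  apply Rnot_lt_le; intros Hlt.
  destruct (proj1 (filterlim_locally _ _) (HPc b)
    (mkposreal (Phi b - Phi x) ltac:(lra))) as [t Ht].
  assert (Hb3 : b <= b - t / 2); [|pose proof (cond_pos t); lra].
  apply Hb2; intros s Hs; apply Rnot_lt_le; intros Hst.
  assert (Hsb : s <= b) by (apply Hb1; exact Hs).
  assert (Hball : Rabs (s - b) < t).
  { pose proof (cond_pos t); apply Rabs_lt_between; lra. }
  specialize (Ht s Hball).
  assert (Ht' : Rabs (Phi s - Phi b) < Phi b - Phi x) by exact Ht.
  rewrite Hs in Ht'; apply Rabs_lt_between in Ht'; lra.
Qed.

Lemma semiconjugacy_increasing d tau F Phi rho :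
  (forall k, (k < d)%nat -> 0 < tau k < 1) -> sumR d tau > 1 ->
  (forall k, (k < d)%nat -> circle_diffeo_C1tau (tau k) (F k)) ->
  (forall i j x, (i < d)%nat -> (j < d)%nat -> F i (F j x) = F j (F i x)) ->
  rationally_independent d rho ->
  degree_one Phi -> monotone Phi -> (forall x, continuous Phi x) ->
  (forall k x, (k < d)%nat -> Phi (F k x) = Phi x + rho k) ->
  forall x y, x < y -> Phi x < Phi y.
Proof.
  intros Htau Hsum HF Hcom Hind HP HPm HPc HPr a y Hay.
  destruct (HPm a y) as [H|Eay]; [lra|exact H|exfalso].
  destruct (plateau_ex Phi a y HP HPm HPc Hay Eay) as [b [Hab [Eb Hb]]].
  assert (HFh : forall k, (k < d)%nat -> circle_homeo_lift (F k))
    by (intros k Hk; apply circle_diffeo_homeo with (tau k), HF, Hk).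
  assert (HPw := fun v => word_semiconjugacy F d v Phi rho HPr).
  set (len := fun v => word F d v b - word F d v a).
  destruct (cheap_path d len tau Htau Hsum) as [C HC].
  { intros v; assert (word F d v a < word F d v b)
      by (apply word_increasing; [exact HFh|lra]); unfold len; lra. }
  { intros s Hs Hsupp; apply (sum_disjoint_arcs (fun v => word F d v a)
      (fun v => word F d v b)); [exact Hs| |].
    - intros v _; split; [left; apply word_increasing; [exact HFh|lra]|].
      rewrite <- (word_degree_one F d v HFh).
      destruct (proj2 Hab) as [H| ->]; [left; apply word_increasing; auto|apply Rle_refl].
    - intros v w m Hv Hw Hvw.
      (* [Phi] is constant on each image interval. By independence its values for [v] and [w] differ
         modulo 1, and monotonicity then orders the intervals. *)
      assert (Hne : Phi (word F d v a) + IZR m <> Phi (word F d w a)).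
      { intros E; apply Hvw, functional_extensionality; intros i.
        destruct (Nat.lt_ge_cases i d) as [Hi|Hi].
        - rewrite !HPw in E; apply (independent_combinations d rho v w m Hind); [lra|exact Hi].
        - rewrite (Hsupp v i Hv Hi), (Hsupp w i Hw Hi); reflexivity. }
      assert (Hva : Phi (word F d v b) = Phi (word F d v a)) by (rewrite !HPw; lra).
      assert (Hwa : Phi (word F d w b) = Phi (word F d w a)) by (rewrite !HPw; lra).
      destruct (Rtotal_order (Phi (word F d v a) + IZR m) (Phi (word F d w a)))
        as [H|[H|H]]; [left|contradiction|right]; apply Rnot_lt_le; intros Hlt;
        apply Rlt_le, HPm in Hlt; rewrite (degree_one_IZR Phi HP) in Hlt; lra. }
  destruct (uniform_distortion d tau F Htau HF) as [K [HK Hdist]].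
  (* The length of [[b, b']] makes the initial condition of [lattice_path_ratio] an equality, with
     [C] the uniform cost bound; it does not depend on the path. *)
  set (b' := b + (b - a) * exp (- (2 * K * C))).
  assert (Hb' : b < b').
  { pose proof (exp_pos (- (2 * K * C))).
    assert (0 < (b - a) * exp (- (2 * K * C))) by (apply Rmult_lt_0_compat; lra).
    unfold b'; lra. }
  destruct (degree_one_uniformly_continuous Phi HP HPc (Phi b' - Phi b))
    as [delta [Hdelta Hunif]].
  { specialize (Hb b' Hb'); lra. }
  destruct (HC delta Hdelta) as [v [c [Hpath [Hc Hlen]]]].
  assert (Hratio : (word F d v b' - word F d v b) * exp (2 * K * (C - c)) <= len v).
  { apply lattice_path_ratio with (tau := tau); auto; [lra|].
    unfold b'; replace (b + (b - a) * exp (- (2 * K * C)) - b)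
      with ((b - a) * exp (- (2 * K * C))) by ring.
    rewrite Rmult_assoc, <- exp_plus, Rplus_opp_l, exp_0; lra. }
  assert (Hbb : word F d v b < word F d v b') by (apply word_increasing; auto).
  assert (Hexp : 1 <= exp (2 * K * (C - c))).
  { rewrite <- exp_0; apply exp_monotone, Rmult_le_pos; lra. }
  assert (Hsmall : word F d v b' - word F d v b <= len v).
  { apply Rle_trans with (2 := Hratio).
    rewrite <- (Rmult_1_r (word F d v b' - word F d v b)) at 1.
    apply Rmult_le_compat_l; lra. }
  (* The image of [[b, b']] is shorter than [delta], yet [Phi] grows on it by exactly
     [Phi b' - Phi b], since [Phi] turns [F^v] into a translation. *)
  specialize (Hunif (word F d v b) (word F d v b')).
  rewrite !HPw in Hunif; lra.
Qed.

Theorem theoremA (d : nat) (tau : nat -> R) (F : nat -> R -> R) :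
  (2 <= d)%nat ->
  (forall k, (k < d)%nat -> 0 < tau k < 1) ->
  sumR d tau > 1 ->
  (forall k, (k < d)%nat -> circle_diffeo_C1tau (tau k) (F k)) ->
  (forall j k, (j < d)%nat -> (k < d)%nat -> circle_commute (F j) (F k)) ->
  rationally_independent d (fun k => rot_num (F k)) ->
  exists Phi : R -> R,
    circle_homeo_lift Phi /\
    forall k, (k < d)%nat ->
      conj_to_rotation Phi (F k).
Proof.
  intros Hd Htau Hsum HF Hcom Hind.
  assert (HFh : forall k, (k < d)%nat -> circle_homeo_lift (F k))
    by (intros k Hk; apply circle_diffeo_homeo with (tau k), HF, Hk).
  assert (Hcomm : forall i j x, (i < d)%nat -> (j < d)%nat -> F i (F j x) = F j (F i x)).
  { intros i j x Hi Hj; apply lifts_commute; auto;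
      (apply HFh || apply homeo_monotone, HFh); assumption. }
  destruct (semiconjugacy_ex d F) as [Phi [rho [HP [HPm HPr]]]].
  { intros k Hk; split; [apply HFh|apply homeo_monotone, HFh]; exact Hk. }
  { intros; apply Hcomm; assumption. }
  assert (Hrho : rationally_independent d rho).
  { intros q [r Hr]; apply Hind; exists r; rewrite <- Hr.
    apply sumR_ext; intros k Hk.
    rewrite (rot_num_semiconjugacy (F k) Phi (rho k)); auto. }
  assert (HPc : forall x, continuous Phi x).
  { apply semiconjugacy_continuous with (F := F 0%nat) (r := rho 0%nat); auto;
      [apply HFh; lia|apply HFh; lia|apply HFh; lia|intros; apply HPr; lia|].
    intros i j m Hij E; apply Hij.
    (* Irrationality of [rho 0] is independence for the multi-indices [(n, 0, ..., 0)]. *)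
    assert (Hs : forall n, sumR d (fun k => INR (upd (fun _ => 0%nat) 0 n k) * rho k)
      = INR n * rho 0%nat).
    { intros n; clear - Hd; destruct d as [|d]; [lia|]; clear.
      induction d as [|d IH]; [cbn [sumR]; rewrite upd_same; ring|].
      cbn [sumR] in *; rewrite IH, (upd_other _ 0 n (S d)) by lia; simpl; ring. }
    rewrite <- (upd_same (fun _ => 0%nat) 0 i), <- (upd_same (fun _ => 0%nat) 0 j).
    apply (independent_combinations d rho _ _ m Hrho); [|lia].
    rewrite !Hs; exact E. }
  exists Phi; split.
  - split; [exact HP|split; [exact HPc|]].
    apply semiconjugacy_increasing with d tau F rho; auto.
  (* The relation holds exactly on the lifts, so the integer correction is 0. *)
  - intros k Hk; exists (rho k); intros x; exists 0%Z.
    rewrite HPr by exact Hk; ring.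
Qed.
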